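(* Let $f$ be a point on the real (resp. complex) projective plane and let $f_1,f_2,f_3,f_4$ be four generic lines. For each of the six pairs $1\le i<j\le4$, pick a point $f_{ij}$ on the line passing through $f$ and $f_i\cap f_j$, so that the eleven inputs $f,f_i,f_{ij}$ are generic subject to these conditions (equivalently, the six tiles with cyclic labels $(f,f_i,f_{ij},f_j)$ are coherent). For each triple $1\le i<j<k\le4$, the triangle with sides $f_i,f_j,f_k$ and the triangle with vertices $f_{ij},f_{ik},f_{jk}$ are in perspective; let $f_{ijk}$ be their Desargues line (equivalently, the unique line such that the tiles $(f_i,f_{ij},f_{ijk},f_{ik})$, $(f_j,f_{ij},f_{ijk},f_{jk})$, $(f_k,f_{ik},f_{ijk},f_{jk})$ are coherent). Then the six lines obtained by connecting $f_{ij}$ with $f_{ijk}\cap f_{ij\ell}$, where $\{i,j,k,\ell\}=\{1,2,3,4\}$, intersect in a point; that is, there exists a unique point $f_{1234}$ such that all tiles of the 4-dimensional cube, including the six tiles $(f_{ij},f_{ijk},f_{1234},f_{ij\ell})$, are coherent.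
   Context: Conventions: $f_{ij}=f_{ji}$, $f_{ijk}=f_{jik}=f_{ikj}=\cdots$. $(XY)$ denotes the line through distinct points $X,Y$. A tile with vertices labeled cyclically by $A,\ell,B,m$, where $A,B$ are points and $\ell,m$ are lines in the projective plane, is coherent if neither $A$ nor $B$ lies on $\ell$ or $m$, and either $A=B$, or $\ell=m$, or the line $(AB)$ passes through the point $\ell\cap m$. The notion does not depend on which vertex is listed first or on the direction of listing. The Desargues line of two perspective triangles is the line containing the three intersection points of corresponding sides; here the side $f_i$ corresponds to the side $(f_{ij}f_{ik})$, so $f_{ijk}$ contains $f_i\cap(f_{ij}f_{ik})$, $f_j\cap(f_{ij}f_{jk})$, $f_k\cap(f_{ik}f_{jk})$. The labels $f_I$ are placed at the vertices of the 4-cube indexed by subsets $I\subset\{1,2,3,4\}$; tiles are the 2-dimensional faces. ''Generic'' means belonging to a suitable Zariski dense (concretely, nonempty Zariski open) subset of the space of configurations satisfying the stated conditions. *)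

(* Defs.v *)
From mathcomp Require Import all_boot all_order all_algebra.
From mathcomp Require Import mpoly complex reals.

Set Implicit Arguments.
Unset Strict Implicit.
Unset Printing Implicit Defensive.

Import GRing.Theory.
Local Open Scope ring_scope.

Section Plane.

Variable K : fieldType.

(* Points and lines of the projective plane P(K^3) are the subspaces of K^3
   of dimension 1 and 2: incidence is inclusion, the line joining two distinct
   points is their sum, and two distinct lines meet in their intersection. *)
Definition flat := {vspace 'rV[K]_3}.

Implicit Types A B l m D P : flat.

Definition is_point A : bool := \dim A == 1%N.
Definition is_line l : bool := \dim l == 2%N.

Definition coherent A l B m : Prop :=
  [/\ [/\ is_point A, is_line l, is_point B & is_line m],
      ~~ (A <= l)%VS /\ ~~ (A <= m)%VS,
      ~~ (B <= l)%VS /\ ~~ (B <= m)%VS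
    & A = B \/ l = m \/ (l :&: m <= A + B)%VS].

Definition triangle A B C : bool :=
  [&& is_point A, is_point B, is_point C & \dim (A + B + C) == 3%N].

Definition perspective A1 A2 A3 B1 B2 B3 : Prop :=
  [/\ triangle A1 A2 A3, triangle B1 B2 B3,
      [/\ A1 != B1, A2 != B2 & A3 != B3]
    & exists2 O, is_point O
        & [/\ (O <= A1 + B1)%VS, (O <= A2 + B2)%VS & (O <= A3 + B3)%VS]].

(* l1, l2, l3 and m1, m2, m3 are the corresponding sides of two triangles. *)
Definition desargues_line l1 l2 l3 m1 m2 m3 D : Prop :=
  [/\ is_line D, [/\ l1 != m1, l2 != m2 & l3 != m3]
    & [/\ (l1 :&: m1 <= D)%VS, (l2 :&: m2 <= D)%VS & (l3 :&: m3 <= D)%VS]].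

(* The vertices of the 4-cube are the subsets I of {0, 1, 2, 3}; the label at
   I is a point when #|I| is even, a line when #|I| is odd. *)
Definition labelling := {set 'I_4} -> flat.

Implicit Types f : labelling.

(* The face with vertices I, I + i, I + i + j, I + j, in cyclic order. *)
Definition coherent_face f (I : {set 'I_4}) (i j : 'I_4) : Prop :=
  if odd #|I| then
    coherent (f (i |: I)) (f (i |: (j |: I))) (f (j |: I)) (f I)
  else
    coherent (f I) (f (i |: I)) (f (i |: (j |: I))) (f (j |: I)).

Definition coherent_cube f : Prop :=
  forall (I : {set 'I_4}) (i j : 'I_4),
    (i < j)%N -> i \notin I -> j \notin I -> coherent_face f I i j.

Definition set_top f P : labelling := fun I => if I == setT then P else f I.

(* Triangle with sides f_i, f_j, f_k against the triangle f_jk, f_ik, f_ij. *)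
Definition perspective_at f (i j k : 'I_4) : Prop :=
  perspective
    (f [set j] :&: f [set k])%VS (f [set i] :&: f [set k])%VS
    (f [set i] :&: f [set j])%VS
    (f [set j; k]) (f [set i; k]) (f [set i; j]).

Definition desargues_at f (i j k : 'I_4) D : Prop :=
  desargues_line (f [set i]) (f [set j]) (f [set k])
    (f [set i; j] + f [set i; k])%VS
    (f [set i; j] + f [set j; k])%VS
    (f [set i; k] + f [set j; k])%VS D.

Definition coherent_at f (i j k : 'I_4) D : Prop :=
  [/\ coherent (f [set i; j]) D (f [set i; k]) (f [set i]),
      coherent (f [set i; j]) D (f [set j; k]) (f [set j])
    & coherent (f [set i; k]) D (f [set j; k]) (f [set k])].

(* P is a common point of the six lines joining f_ij with the intersection of
   f_ijk and f_ijl, these six lines being well defined. *)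
Definition concurrent_at f P : Prop :=
  is_point P /\
  forall i j k l : 'I_4, uniq [:: i; j; k; l] ->
    let X := (f [set i; j; k] :&: f [set i; j; l])%VS in
    [/\ is_point X, is_line (f [set i; j] + X)%VS & (P <= f [set i; j] + X)%VS].

(* The space of admissible inputs; only the eleven labels f I with
   #|I| <= 2 are constrained. *)
Definition input_space f : Prop :=
  [/\ is_point (f set0), forall i : 'I_4, is_line (f [set i])
    & forall i j : 'I_4, (i < j)%N ->
      let X := (f [set i] :&: f [set j])%VS in
      [/\ f [set i] != f [set j], f set0 != X, is_point (f [set i; j])
        & (f [set i; j] <= f set0 + X)%VS]].

Definition input := {I : {set 'I_4} | (#|I| <= 2)%N}.

Definition point_coord (w : 'rV[K]_3) A : Prop := w != 0 /\ A = <[w]>%VS.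

Definition line_coord (w : 'rV[K]_3) l : Prop :=
  w != 0 /\ forall v : 'rV[K]_3, (v \in l) = (v *m w^T == 0).

Definition input_coord (c : input -> 'rV[K]_3) f : Prop :=
  forall I : input,
    if odd #|val I| then line_coord (c I) (f (val I))
    else point_coord (c I) (f (val I)).

Definition nvars := #|{: input * 'I_3}|.

Definition flatten_coord (c : input -> 'rV[K]_3) (a : 'I_nvars) : K :=
  c (enum_val a).1 0 (enum_val a).2.

(* Zariski topology on the input space, as the quotient topology from systems
   of homogeneous coordinates: U is open when a system of coordinates of an
   input configuration represents an element of U if and only if some member
   of a fixed family S of polynomials in these coordinates does not vanish
   there. In particular U f only depends on the eleven inputs. *)
Definition zariski_open (U : labelling -> Prop) : Prop :=
  (forall f, U f -> input_space f) /\
  exists S : {mpoly K[nvars]} -> Prop,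
    forall f (c : input -> 'rV[K]_3), input_space f -> input_coord c f ->
      (U f <-> exists2 p, S p & p.@[flatten_coord c] != 0).

Definition zariski_dense (U : labelling -> Prop) : Prop :=
  forall V : labelling -> Prop, zariski_open V ->
    (exists f, V f) -> exists2 f, U f & V f.

Definition generically (Q : labelling -> Prop) : Prop :=
  exists U : labelling -> Prop,
    [/\ zariski_open U, exists f, U f, zariski_dense U & forall f, U f -> Q f].

End Plane.

(* Main.v *)
Require Import Defs.
From mathcomp Require Import all_boot all_order all_algebra.
From mathcomp Require Import mpoly complex reals.
From mathcomp Require Import ring.
From Stdlib Require Import FunctionalExtensionality.

Set Implicit Arguments.
Unset Strict Implicit.
Unset Printing Implicit Defensive.

Import GRing.Theory.
Local Open Scope ring_scope.

(** Give every point of the plane a vector and every line a covector, and write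
    A.l for their pairing.  By the Binet-Cauchy identity the tile (A, l, B, m)
    is coherent if and only if the four pairings are nonzero and
    (A.l) (B.m) = (B.l) (A.m) (lemma [coherentE]).  So a labelled cube is
    coherent as soon as its vectors can be scaled so that each line takes one
    and the same nonzero value on all the points adjacent to it in the cube
    (lemma [coherent_face_balanced]).

    Write q for the vector of f, l_i for the covector of f_i, and scale the
    vectors F_ij of the points f_ij so that l_i takes one value k_i on q and on
    all the F_ij.  Read these vectors in the affine space K^3: the affine
    planes l_i = k_i pass through q, and F_ij lies on the intersection of the
    planes numbered i and j.  The side (f_ij f_ik) meets f_i in the point
    F_ij - F_ik, so the Desargues line f_ijk is the direction of the affine
    plane through F_ij, F_ik and F_jk; its covector n_ijk can be scaled to take
    the value 1 on these three vectors, and n_ijk = 1 is an equation of that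
    plane.  A vector P then completes the coherent labelling when all four
    n_ijk take the value 1 on P, that is, when P is common to the four affine
    planes.  That four such planes have a common point is Cox's theorem
    (lemma [cox]), which is proved by an explicit formula for P: in suitable
    unknowns the four equations form a skew-symmetric linear system.

    For uniqueness, both the coherence of the top tiles and the concurrency of
    the six lines say that the n_ijk take equal values on a vector of the
    point (lemmas [join_meet] and [cube_unique]); as three of the n_ijk are
    linearly independent, the point is <[P]> (lemma [top_unique]).

    All this holds where a single polynomial, [nondegeneracy], in the
    coordinates of the inputs does not vanish.  It defines an open set because
    any two systems of coordinates of an input differ by a scaling
    ([generic_locus_open]).  Nonempty open sets meet because the input space
    is parametrized by polynomials on an affine space: along the segment
    between two choices of the parametrizing data every open condition is a
    nonzero polynomial in one variable ([zariski_open_meet]).  The set is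
    nonempty by an explicit configuration ([generic_locus_nonempty]). *)

(** * Vectors of K^3 *)

Definition ord3_0 : 'I_3 := @Ordinal 3 0 isT.
Definition ord3_1 : 'I_3 := @Ordinal 3 1 isT.
Definition ord3_2 : 'I_3 := @Ordinal 3 2 isT.

Section VectorAlgebra.
Variable R : comNzRingType.
Implicit Types u v w z : 'rV[R]_3.

Definition vec3 (a b c : R) : 'rV[R]_3 := \row_j [:: a; b; c]`_j.

Definition dot u v : R :=
  u 0 ord3_0 * v 0 ord3_0 + u 0 ord3_1 * v 0 ord3_1 + u 0 ord3_2 * v 0 ord3_2.

Definition cross u v : 'rV[R]_3 :=
  vec3 (u 0 ord3_1 * v 0 ord3_2 - u 0 ord3_2 * v 0 ord3_1)
       (u 0 ord3_2 * v 0 ord3_0 - u 0 ord3_0 * v 0 ord3_2)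
       (u 0 ord3_0 * v 0 ord3_1 - u 0 ord3_1 * v 0 ord3_0).

Definition det3 u v w : R := dot u (cross v w).

Lemma row3P u v :
  u 0 ord3_0 = v 0 ord3_0 -> u 0 ord3_1 = v 0 ord3_1 ->
  u 0 ord3_2 = v 0 ord3_2 -> u = v.
Proof.
move=> e0 e1 e2; apply/rowP => -[[|[|[|//]]] lt_j].
- by rewrite (_ : Ordinal lt_j = ord3_0) //; apply: val_inj.
- by rewrite (_ : Ordinal lt_j = ord3_1) //; apply: val_inj.
- by rewrite (_ : Ordinal lt_j = ord3_2) //; apply: val_inj.
Qed.

End VectorAlgebra.

Ltac vring :=
  try apply: row3P; rewrite /det3 /dot /cross /vec3 ?mxE /=; ring.

Section VectorIdentities.
Variable R : comNzRingType.
Implicit Types (u v w z : 'rV[R]_3) (a b c : R).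

Lemma dotC u v : dot u v = dot v u. Proof. vring. Qed.
Lemma dotDl u v w : dot (u + v) w = dot u w + dot v w. Proof. vring. Qed.
Lemma dotBl u v w : dot (u - v) w = dot u w - dot v w. Proof. vring. Qed.
Lemma dotZl a u v : dot (a *: u) v = a * dot u v. Proof. vring. Qed.
Lemma dotBr u v w : dot w (u - v) = dot w u - dot w v. Proof. vring. Qed.
Lemma dotZr a u v : dot v (a *: u) = a * dot v u. Proof. vring. Qed.
Lemma dot0v u : dot 0 u = 0. Proof. vring. Qed.
Lemma dotv0 u : dot u 0 = 0. Proof. vring. Qed.

Lemma crossC u v : cross u v = - cross v u. Proof. vring. Qed.
Lemma crossZZ a b u v : cross (a *: u) (b *: v) = (a * b) *: cross u v.
Proof. vring. Qed.
Lemma det3ZZZ a b c u v w :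
  det3 (a *: u) (b *: v) (c *: w) = a * b * c * det3 u v w.
Proof. vring. Qed.
Lemma crossvv u : cross u u = 0. Proof. vring. Qed.
Lemma cross0v u : cross 0 u = 0. Proof. vring. Qed.
Lemma crossv0 u : cross u 0 = 0. Proof. vring. Qed.
Lemma dot_crossl u v : dot u (cross u v) = 0. Proof. vring. Qed.
Lemma dot_crossr u v : dot v (cross u v) = 0. Proof. vring. Qed.

(** The Binet-Cauchy identity. *)
Lemma dot_cross_cross u v w z :
  dot (cross u v) (cross w z) = dot u w * dot v z - dot u z * dot v w.
Proof. vring. Qed.

Lemma cross_cross u v w :
  cross u (cross v w) = dot u w *: v - dot u v *: w.
Proof. vring. Qed.

(** Cramer's rule: [z] is determined by its pairings with three independent
    covectors. *)
Lemma det3_expand u v w z :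
  det3 u v w *: z
  = dot z u *: cross v w + dot z v *: cross w u + dot z w *: cross u v.
Proof. vring. Qed.

End VectorIdentities.

(** * Cox's theorem on four planes through a point *)

Section Cox.
Variable R : comNzRingType.
Implicit Types (u v w z q l m : 'rV[R]_3) (r s t : R).

(** The plane through [u], [v] and [w] is where [normal u v w] takes the
    value [det3 u v w]. *)
Definition normal u v w := cross (u - v) (u - w).

Lemma dot_normal1 u v w : dot u (normal u v w) = det3 u v w.
Proof. rewrite /normal; vring. Qed.
Lemma dot_normal2 u v w : dot v (normal u v w) = det3 u v w.
Proof. rewrite /normal; vring. Qed.
Lemma dot_normal3 u v w : dot w (normal u v w) = det3 u v w.
Proof. rewrite /normal; vring. Qed.

(** [normal] of the points q + r_ij (l_i x l_j), for i < j in {1, 2, 3}, is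
    proportional to this covector by [normal_plane_covector]. The reason is
    the identity (l_i x l_j) x (l_i x l_k) = det (l_i, l_j, l_k) l_i. *)
Definition plane_covector l1 l2 l3 r12 r13 r23 :=
  (r12 * r13) *: l1 - (r12 * r23) *: l2 + (r13 * r23) *: l3.

Lemma normal_plane_covector q l1 l2 l3 r12 r13 r23 :
  normal (q + r12 *: cross l1 l2) (q + r13 *: cross l1 l3)
         (q + r23 *: cross l2 l3)
  = det3 l1 l2 l3 *: plane_covector l1 l2 l3 r12 r13 r23.
Proof. rewrite /normal /plane_covector; vring. Qed.

(** Up to sign, the product of the six r_ij times the Pfaffian of the
    skew-symmetric matrix with entries 1 / r_ij. *)
Definition cox_weight r12 r13 r14 r23 r24 r34 :=
  r12 * r34 * (r14 * r23) - r12 * r34 * (r13 * r24) - r13 * r24 * (r14 * r23).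

(** Divided by [cox_weight], this is the vector from q to the common point of
    the four planes. Put y_i = l_i.v and let m be the vector of the signed
    minors of the l_i, so that m.y = 0 is the only condition on y. Dividing
    the equations of the planes by the r_ij turns them into A y = m, where A
    is the Pfaffian adjoint of the skew-symmetric matrix U of the 1 / r_ij.
    The solution y = U m / Pf U satisfies m.y = 0 because U is
    skew-symmetric, and this is the corresponding vector v with the
    denominators cleared. *)
Definition cox_vector l1 l2 l3 l4 r12 r13 r14 r23 r24 r34 :=
   (r12 * r34 * (r14 * r23)) *: (r13 *: cross l1 l3 + r24 *: cross l2 l4)
  - (r12 * r34 * (r13 * r24)) *: (r14 *: cross l1 l4 + r23 *: cross l2 l3)
  - (r13 * r24 * (r14 * r23)) *: (r12 *: cross l1 l2 + r34 *: cross l3 l4).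

Lemma cox_plane123 l1 l2 l3 l4 r12 r13 r14 r23 r24 r34 :
  dot (cox_vector l1 l2 l3 l4 r12 r13 r14 r23 r24 r34)
      (plane_covector l1 l2 l3 r12 r13 r23)
  = cox_weight r12 r13 r14 r23 r24 r34 *
    dot (r12 *: cross l1 l2) (plane_covector l1 l2 l3 r12 r13 r23).
Proof. rewrite /plane_covector /cox_vector /cox_weight; vring. Qed.

Lemma cox_plane124 l1 l2 l3 l4 r12 r13 r14 r23 r24 r34 :
  dot (cox_vector l1 l2 l3 l4 r12 r13 r14 r23 r24 r34)
      (plane_covector l1 l2 l4 r12 r14 r24)
  = cox_weight r12 r13 r14 r23 r24 r34 *
    dot (r12 *: cross l1 l2) (plane_covector l1 l2 l4 r12 r14 r24).
Proof. rewrite /plane_covector /cox_vector /cox_weight; vring. Qed.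

Lemma cox_plane134 l1 l2 l3 l4 r12 r13 r14 r23 r24 r34 :
  dot (cox_vector l1 l2 l3 l4 r12 r13 r14 r23 r24 r34)
      (plane_covector l1 l3 l4 r13 r14 r34)
  = cox_weight r12 r13 r14 r23 r24 r34 *
    dot (r13 *: cross l1 l3) (plane_covector l1 l3 l4 r13 r14 r34).
Proof. rewrite /plane_covector /cox_vector /cox_weight; vring. Qed.

Lemma cox_plane234 l1 l2 l3 l4 r12 r13 r14 r23 r24 r34 :
  dot (cox_vector l1 l2 l3 l4 r12 r13 r14 r23 r24 r34)
      (plane_covector l2 l3 l4 r23 r24 r34)
  = cox_weight r12 r13 r14 r23 r24 r34 *
    dot (r23 *: cross l2 l3) (plane_covector l2 l3 l4 r23 r24 r34).
Proof. rewrite /plane_covector /cox_vector /cox_weight; vring. Qed.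

(** This is how the independence of three of the planes makes the weight
    invertible. *)
Lemma det3_plane_covector l1 l2 l3 l4 r12 r13 r14 r23 r24 r34 :
  det3 (plane_covector l1 l2 l3 r12 r13 r23)
       (plane_covector l1 l2 l4 r12 r14 r24)
       (plane_covector l1 l3 l4 r13 r14 r34)
  = - cox_weight r12 r13 r14 r23 r24 r34 *
    (r12 * r13 * det3 l1 l2 l3 - r12 * r14 * det3 l1 l2 l4
     + r13 * r14 * det3 l1 l3 l4).
Proof. rewrite /plane_covector /cox_weight; vring. Qed.

End Cox.

(** Cox's theorem in affine space: F_ij is on the intersection of the planes
    i and j through q, and P is on the plane through F_ij, F_ik and F_jk. The
    weight is nonzero because it divides the determinant of three of the
    normals, and the point is q + cox_vector / cox_weight. *)
Lemma cox (K : fieldType) (q l1 l2 l3 l4 F12 F13 F14 F23 F24 F34 : 'rV[K]_3)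
    (r12 r13 r14 r23 r24 r34 : K) :
  F12 = q + r12 *: cross l1 l2 -> F13 = q + r13 *: cross l1 l3 ->
  F14 = q + r14 *: cross l1 l4 -> F23 = q + r23 *: cross l2 l3 ->
  F24 = q + r24 *: cross l2 l4 -> F34 = q + r34 *: cross l3 l4 ->
  det3 (normal F12 F13 F23) (normal F12 F14 F24) (normal F13 F14 F34) != 0 ->
  exists P, [/\ dot P (normal F12 F13 F23) = det3 F12 F13 F23,
                dot P (normal F12 F14 F24) = det3 F12 F14 F24,
                dot P (normal F13 F14 F34) = det3 F13 F14 F34
              & dot P (normal F23 F24 F34) = det3 F23 F24 F34].
Proof.
move=> -> -> -> -> -> ->; set N := det3 _ _ _ => N_neq0.
set om := cox_weight r12 r13 r14 r23 r24 r34.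
have om_neq0 : om != 0.
  apply: contraNneq N_neq0 => om0; rewrite /N !normal_plane_covector.
  by rewrite det3ZZZ det3_plane_covector -/om om0 oppr0 mul0r mulr0.
exists (q + om^-1 *: cox_vector l1 l2 l3 l4 r12 r13 r14 r23 r24 r34).
rewrite -!dot_normal1 !normal_plane_covector !(dotDl, dotZr) !(dotZl om^-1).
rewrite cox_plane123 cox_plane124 cox_plane134 cox_plane234 -/om.
by rewrite !(mulKf om_neq0) !mulrDr.
Qed.

(** * Points and lines as kernels and spans *)

Section Incidence.
Variable K : fieldType.
Implicit Types (a b l m u v w : 'rV[K]_3) (A B D : flat K).

Lemma dot_neq0 u : u != 0 -> exists w, dot w u != 0.
Proof.
move=> u_neq0; case: (eqVneq (u 0 ord3_0) 0) => [u0|]; last first.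
  by exists (vec3 1 0 0); rewrite /dot /vec3 !mxE /= !mul0r !addr0 mul1r.
case: (eqVneq (u 0 ord3_1) 0) => [u1|]; last first.
  by exists (vec3 0 1 0); rewrite /dot /vec3 !mxE /= !mul0r add0r addr0 mul1r.
exists (vec3 0 0 1); rewrite /dot /vec3 !mxE /= !mul0r !add0r mul1r.
by apply: contraNneq u_neq0 => u2; apply/eqP/row3P; rewrite ?mxE.
Qed.

(** The double cross product with a [w] that does not annihilate [u]
    expresses [v] through [u]. *)
Lemma cross_eq0 u v : u != 0 -> cross u v = 0 -> exists k, v = k *: u.
Proof.
move=> /dot_neq0[w wu_neq0] uv0; exists (dot w v / dot w u).
have /eqP := cross_cross w u v; rewrite uv0 crossv0 eq_sym subr_eq0 => /eqP e.
by rewrite mulrC -scalerA e scalerA mulVf // scale1r.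
Qed.

Lemma dot_ortho2 v l m :
  cross l m != 0 -> dot v l = 0 -> dot v m = 0 -> exists k, v = k *: cross l m.
Proof.
move=> lm vl vm; apply: cross_eq0 => //.
by rewrite crossC cross_cross vl vm !scale0r subrr oppr0.
Qed.

Lemma det3_ortho u v w z :
  det3 u v w != 0 -> dot z u = 0 -> dot z v = 0 -> dot z w = 0 -> z = 0.
Proof.
move=> d zu zv zw; have /eqP := det3_expand u v w z.
by rewrite zu zv zw !scale0r !addr0 scaler_eq0 (negPf d) => /eqP.
Qed.

(** The line with covector [l]. *)
Definition kerl l : flat K := lker (linfun (mulmxr l^T : 'rV_3 -> 'M_1)).

Lemma dotE u v : u *m v^T = (dot u v)%:M.
Proof.
apply/rowP=> j; rewrite !ord1 !mxE /= mulr1n !big_ord_recl big_ord0 addr0 !mxE.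
rewrite /dot addrA; congr (_ * _ + _ * _ + _ * _); congr (_ _ _);
  exact: val_inj.
Qed.

Lemma mem_kerl l v : (v \in kerl l) = (dot v l == 0).
Proof.
rewrite memv_ker lfunE /= dotE; apply/eqP/eqP => [/matrixP/(_ 0 0)|->].
  by rewrite !mxE mulr1n.
by rewrite raddf0.
Qed.

Lemma dim_kerl l : l != 0 -> \dim (kerl l) = 2%N.
Proof.
move=> l_neq0; have [w wl] := dot_neq0 l_neq0.
have := limg_ker_dim (linfun (mulmxr l^T : 'rV_3 -> 'M_1)) fullv.
rewrite capfv -/(kerl l) !dimvf /dim /= => e.
set f := linfun _ in e.
suff d1 : \dim (limg f) = 1%N by move: e; rewrite d1 mul1n addn1 => -[].
apply/eqP; rewrite eqn_leq; apply/andP; split.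
  by rewrite (leq_trans (dimvS (subvf _))) // dimvf.
rewrite lt0n dimv_eq0; apply: contraNneq wl => f0.
have : f w \in limg f by rewrite memv_img ?memvf.
by rewrite f0 memv0 -memv_ker -/(kerl l) mem_kerl.
Qed.

Lemma vline_kerl a l : (<[a]> <= kerl l)%VS = (dot a l == 0).
Proof. by rewrite -memvE mem_kerl. Qed.

Lemma pointP A : reflect (exists2 a, a != 0 & A = <[a]>%VS) (is_point A).
Proof.
apply: (iffP eqP) => [dA|[a a_neq0 ->]]; last by rewrite dim_vline a_neq0.
have A_neq0 : vpick A != 0 by rewrite vpick0 -dimv_eq0 dA.
exists (vpick A) => //; apply/esym/eqP.
by rewrite eqEdim dim_vline A_neq0 dA -memvE memv_pick.
Qed.

Lemma cross_line a b : a != 0 -> b \notin <[a]>%VS -> cross a b != 0.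
Proof.
move=> a_neq0; apply: contraNneq => /(cross_eq0 a_neq0)[k ->].
by apply/vlineP; exists k.
Qed.

Lemma cross_neq0l a b : cross a b != 0 -> a != 0.
Proof. by apply: contraNneq => ->; rewrite cross0v. Qed.

Lemma cross_neq0r a b : cross a b != 0 -> b != 0.
Proof. by apply: contraNneq => ->; rewrite crossv0. Qed.

Lemma vline_addv a b : cross a b != 0 -> (<[a]> + <[b]>)%VS = kerl (cross a b).
Proof.
move=> ab; have a_neq0 := cross_neq0l ab; have b_neq0 := cross_neq0r ab.
apply/eqP; rewrite eqEdim dim_kerl // subv_add !vline_kerl.
rewrite dot_crossl dot_crossr !eqxx /=.
rewrite dimv_disjoint_sum ?dim_vline ?a_neq0 ?b_neq0 //.
apply/eqP; rewrite -subv0; apply/subvP=> v; rewrite memv_cap memv0.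
case/andP=> /vlineP[k ->] /vlineP[k' e]; case: (eqVneq k 0) => [->|k_neq0].
  by rewrite scale0r.
case/negP: ab; apply/eqP.
by rewrite -[a]scale1r -(mulVf k_neq0) -scalerA e -[b in cross _ b]scale1r
  scalerA crossZZ crossvv scaler0.
Qed.

Lemma lineP A : reflect (exists2 l, l != 0 & A = kerl l) (is_line A).
Proof.
apply: (iffP eqP) => [dA|[l l_neq0 ->]]; last by rewrite dim_kerl.
have a_neq0 : vpick A != 0 by rewrite vpick0 -dimv_eq0 dA.
have aA : (<[vpick A]> <= A)%VS by rewrite -memvE memv_pick.
have /subvPn[b bA ba] : ~~ (A <= <[vpick A]>)%VS.
  by apply/negP=> /dimvS; rewrite dA dim_vline a_neq0.
have ab := cross_line a_neq0 ba; exists (cross (vpick A) b) => //.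
apply/esym/eqP; rewrite -vline_addv // eqEdim subv_add aA -memvE bA /=.
by rewrite vline_addv // dim_kerl // dA.
Qed.

Lemma vline_eq a b : a != 0 -> b != 0 ->
  (<[a]>%VS == <[b]>%VS) = (cross a b == 0).
Proof.
move=> a_neq0 b_neq0; apply/eqP/eqP => [e|ab].
  have /vlineP[k ->] : b \in <[a]>%VS by rewrite e memv_line.
  by rewrite -[a in cross a]scale1r crossZZ crossvv scaler0.
apply/esym/eqP; rewrite eqEdim !dim_vline a_neq0 b_neq0 -memvE andbT.
by have [k ->] := cross_eq0 a_neq0 ab; apply/vlineP; exists k.
Qed.

Lemma kerl_cap l m :
  cross l m != 0 -> (kerl l :&: kerl m)%VS = <[cross l m]>%VS.
Proof.
move=> lm; apply/vspaceP=> v; rewrite memv_cap !mem_kerl.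
apply/andP/vlineP => [[/eqP vl /eqP vm]|[k ->]]; first exact: dot_ortho2.
by rewrite !dotZl ![dot (cross _ _) _]dotC dot_crossl dot_crossr mulr0.
Qed.

Lemma kerl_eq l m : l != 0 -> m != 0 -> (kerl l == kerl m) = (cross l m == 0).
Proof.
move=> l_neq0 m_neq0; apply/eqP/eqP => [e|lm].
  apply/eqP; apply: contraT => lm; have := kerl_cap lm.
  rewrite -e capvv => /(congr1 (fun A => \dim A)).
  by rewrite dim_kerl ?dim_vline ?lm.
have [k e] := cross_eq0 l_neq0 lm.
have k_neq0 : k != 0 by apply: contraNneq m_neq0 => k0; rewrite e k0 scale0r.
by apply/vspaceP=> v; rewrite !mem_kerl e dotZr mulf_eq0 (negPf k_neq0).
Qed.

End Incidence.

(** * Coherent tiles and Desargues lines in coordinates *)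

Section Tiles.
Variable K : fieldType.
Implicit Types (a b l m u v w d : 'rV[K]_3) (A B D : flat K).

(** When A <> B and l <> m, the line (AB) has covector a x b and the lines l,
    m meet in the point with vector l x m, so the incidence is the vanishing
    of (a x b).(l x m); the degenerate cases A = B and l = m are those where
    one factor is zero. *)
Lemma coherentE a b l m : a != 0 -> b != 0 -> l != 0 -> m != 0 ->
  coherent <[a]>%VS (kerl l) <[b]>%VS (kerl m)
  <-> [/\ dot a l != 0 /\ dot a m != 0, dot b l != 0 /\ dot b m != 0
        & dot a l * dot b m = dot b l * dot a m].
Proof.
move=> a0 b0 l0 m0; rewrite /coherent !vline_kerl.
have pt (x : 'rV[K]_3) : x != 0 -> is_point <[x]>%VS.
  by move=> nz; apply/pointP; exists x.
have ln (x : 'rV[K]_3) : x != 0 -> is_line (kerl x).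
  by move=> nz; apply/lineP; exists x.
have key : (<[a]> = <[b]> \/ kerl l = kerl m
            \/ kerl l :&: kerl m <= <[a]> + <[b]>)%VS
    <-> dot a l * dot b m = dot b l * dot a m.
  have e : dot a l * dot b m - dot b l * dot a m
           = dot (cross l m) (cross a b).
    by rewrite [RHS]dotC dot_cross_cross (mulrC (dot b l)).
  have eP : (dot a l * dot b m == dot b l * dot a m)
            = (dot (cross l m) (cross a b) == 0) by rewrite -subr_eq0 e.
  have [ab|ab] := eqVneq (cross a b) 0.
    rewrite ab dotv0 eqxx in eP; split=> _; first by apply/eqP; rewrite eP.
    by left; apply/eqP; rewrite vline_eq // ab.
  have [lm|lm] := eqVneq (cross l m) 0.
    rewrite lm dot0v eqxx in eP; split=> _; first by apply/eqP; rewrite eP.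
    by right; left; apply/eqP; rewrite kerl_eq // lm.
  split=> [[/eqP|[/eqP|]]|/eqP].
  - by rewrite vline_eq // (negPf ab).
  - by rewrite kerl_eq // (negPf lm).
  - by rewrite kerl_cap // vline_addv // vline_kerl -eP => /eqP.
  - by rewrite eP -vline_kerl -kerl_cap // -vline_addv //; right; right.
split=> [[_ h1 h2 h3]|[h1 h2 h3]]; first by split=> //; apply/key.
by split=> //; [split; auto|apply/key].
Qed.

Lemma triangle_det3 a b c :
  det3 a b c != 0 -> triangle <[a]>%VS <[b]>%VS <[c]>%VS.
Proof.
move=> d; have bc : cross b c != 0.
  by apply: contraNneq d => bc; rewrite /det3 bc dotv0.
have a0 : a != 0 by apply: contraNneq d => ->; rewrite /det3 dot0v.
have [b0 c0] := (cross_neq0l bc, cross_neq0r bc).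
rewrite /triangle /is_point !dim_vline a0 b0 c0 /= -addvA vline_addv //.
rewrite dimv_disjoint_sum ?dim_vline ?dim_kerl // ?a0 //.
apply/eqP; rewrite -subv0; apply/subvP=> v; rewrite memv_cap memv0.
case/andP=> /vlineP[k ->]; rewrite mem_kerl dotZl mulf_eq0 (negPf d) orbF.
by move=> /eqP->; rewrite scale0r.
Qed.

Lemma det3_neq0 a b c : det3 a b c != 0 ->
  [/\ cross a b != 0, cross a c != 0 & cross b c != 0].
Proof.
move=> d; split; apply: contraNneq d => e; last by rewrite /det3 e dotv0.
- have -> : det3 a b c = dot c (cross a b) by vring.
  by rewrite e dotv0.
- have -> : det3 a b c = - dot b (cross a c) by vring.
  by rewrite e dotv0 oppr0.
Qed.

(** The difference of two vectors with the same value on [l] lies on [l]. *)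
Lemma cap_side l a b k : k != 0 -> dot a l = k -> dot b l = k ->
  cross a b != 0 -> (kerl l :&: (<[a]> + <[b]>))%VS = <[a - b]>%VS
    /\ kerl l != (<[a]> + <[b]>)%VS.
Proof.
move=> k0 al bl ab.
have ab_neq0 : a - b != 0.
  by apply: contraNneq ab => /subr0_eq ->; rewrite crossvv.
have l0 : l != 0 by apply: contraNneq k0 => l0; rewrite -al l0 dotv0.
have e : cross l (cross a b) = k *: (a - b).
  by rewrite cross_cross ![dot l _]dotC al bl scalerBr.
have lab : cross l (cross a b) != 0 by rewrite e scaler_eq0 negb_or k0.
rewrite vline_addv // kerl_eq // lab kerl_cap // e; split=> //.
apply/eqP; rewrite vline_eq ?scaler_eq0 ?negb_or ?k0 //.
by rewrite -[X in cross _ X]scale1r crossZZ crossvv scaler0.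
Qed.

Section Desargues.
Variables (l1 l2 l3 F12 F13 F23 : 'rV[K]_3) (k1 k2 k3 : K).
Hypotheses (k1_neq0 : k1 != 0) (k2_neq0 : k2 != 0) (k3_neq0 : k3 != 0).
Hypotheses (F12l1 : dot F12 l1 = k1) (F13l1 : dot F13 l1 = k1).
Hypotheses (F12l2 : dot F12 l2 = k2) (F23l2 : dot F23 l2 = k2).
Hypotheses (F13l3 : dot F13 l3 = k3) (F23l3 : dot F23 l3 = k3).
Hypothesis F_free : det3 F12 F13 F23 != 0.

(** The condition on a covector to define the Desargues line: it kills the
    differences of the F's, which are the intersections of corresponding
    sides by [cap_side]. *)
Definition equal_on d := dot F12 d = dot F13 d /\ dot F12 d = dot F23 d.

Lemma desargues_lineE D :
  desargues_line (kerl l1) (kerl l2) (kerl l3)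
    (<[F12]> + <[F13]>)%VS (<[F12]> + <[F23]>)%VS (<[F13]> + <[F23]>)%VS D
  <-> exists2 d, d != 0 /\ D = kerl d & equal_on d.
Proof.
have [c1 c2 c3] := det3_neq0 F_free; rewrite /desargues_line.
have [-> ->] := cap_side k1_neq0 F12l1 F13l1 c1.
have [-> ->] := cap_side k2_neq0 F12l2 F23l2 c2.
have [-> ->] := cap_side k3_neq0 F13l3 F23l3 c3.
split=> [[/lineP[d d0 ->] _ []]|[d [d0 ->] [e1 e2]]].
  rewrite !vline_kerl !dotBl !subr_eq0 => /eqP e1 /eqP e2 _.
  by exists d.
split=> //; first by apply/lineP; exists d.
by rewrite !vline_kerl !dotBl -e1 -e2 subrr eqxx.
Qed.

Lemma equal_on_neq0 d : d != 0 -> equal_on d -> dot F12 d != 0.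
Proof.
move=> d0 [e1 e2]; apply: contraNneq d0 => e; apply/eqP.
by apply: (det3_ortho F_free); rewrite dotC // -?e1 -?e2.
Qed.

Lemma coherent_side a b l k d : k != 0 -> dot a l = k -> dot b l = k ->
  d != 0 -> coherent <[a]>%VS (kerl d) <[b]>%VS (kerl l)
  <-> dot a d != 0 /\ dot a d = dot b d.
Proof.
move=> k0 al bl d0.
have a0 : a != 0 by apply: contraNneq k0 => e; rewrite -al e dot0v.
have b0 : b != 0 by apply: contraNneq k0 => e; rewrite -bl e dot0v.
have l0 : l != 0 by apply: contraNneq k0 => e; rewrite -bl e dotv0.
rewrite coherentE // al bl; split=> [[[ad _] _ /(mulIf k0)]|[ad <-]] //.
Qed.

(** With the F's scaled to equal values on the l's, coherence of a tile
    around D asks that [d] takes equal values on its two points; these values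
    cannot be zero, because [d] would then vanish on a basis. *)
Lemma coherent_desargues D :
  desargues_line (kerl l1) (kerl l2) (kerl l3)
    (<[F12]> + <[F13]>)%VS (<[F12]> + <[F23]>)%VS (<[F13]> + <[F23]>)%VS D
  <-> [/\ coherent <[F12]>%VS D <[F13]>%VS (kerl l1),
          coherent <[F12]>%VS D <[F23]>%VS (kerl l2)
        & coherent <[F13]>%VS D <[F23]>%VS (kerl l3)].
Proof.
rewrite desargues_lineE; split=> [[d [d0 ->] e]|[c1 c2 c3]].
  have nz := equal_on_neq0 d0 e; case: e => e1 e2.
  split; [apply/(coherent_side k1_neq0)|apply/(coherent_side k2_neq0)
         |apply/(coherent_side k3_neq0)] => //; by rewrite -?e1 -?e2.
have /lineP[d d0 eD] : is_line D by case: c1 => -[].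
rewrite eD in c1 c2; exists d => //; split.
  by have /(coherent_side k1_neq0) -/(_ F12l1 F13l1 d0)[] := c1.
by have /(coherent_side k2_neq0) -/(_ F12l2 F23l2 d0)[] := c2.
Qed.

(** A covector with equal values on a basis is determined up to a scalar. *)
Lemma desargues_unique n : dot F12 n = 1 -> dot F13 n = 1 -> dot F23 n = 1 ->
  forall D, desargues_line (kerl l1) (kerl l2) (kerl l3)
    (<[F12]> + <[F13]>)%VS (<[F12]> + <[F23]>)%VS (<[F13]> + <[F23]>)%VS D
  <-> D = kerl n.
Proof.
move=> n1 n2 n3 D; have n0 : n != 0.
  by apply: contraTneq (oner_neq0 K) => e; rewrite -n1 e dotv0 eqxx.
rewrite desargues_lineE; split=> [[d [d0 ->] e]|->]; last first.
  by exists n; rewrite // /equal_on n1 n2 n3.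
have [e1 e2] := e; apply/eqP; rewrite kerl_eq //; apply/eqP.
suff /subr0_eq -> : d - dot F12 d *: n = 0.
  by rewrite -[X in cross _ X]scale1r crossZZ crossvv scaler0.
by apply: (det3_ortho F_free); rewrite dotC dotBr dotZr ?n1 ?n2 ?n3 mulr1
  -?e1 -?e2 subrr.
Qed.

End Desargues.

(** The center of perspective is the point q itself: it lies on each line
    joining F_ij to the intersection of l_i and l_j. *)
Lemma perspective_from q l1 l2 l3 F12 F13 F23 k1 k2 k3 r12 r13 r23 :
  k1 != 0 -> k2 != 0 -> k3 != 0 ->
  dot q l1 = k1 -> dot q l2 = k2 -> dot q l3 = k3 ->
  F12 = q + r12 *: cross l1 l2 -> F13 = q + r13 *: cross l1 l3 ->
  F23 = q + r23 *: cross l2 l3 ->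
  det3 l1 l2 l3 != 0 -> det3 F12 F13 F23 != 0 ->
  perspective (kerl l2 :&: kerl l3)%VS (kerl l1 :&: kerl l3)%VS
    (kerl l1 :&: kerl l2)%VS <[F23]>%VS <[F13]>%VS <[F12]>%VS.
Proof.
move=> k1_neq0 k2_neq0 k3_neq0 ql1 ql2 ql3 e12 e13 e23 dl dF.
have [c12 c13 c23] := det3_neq0 dl.
have q0 : q != 0 by apply: contraNneq k1_neq0 => e; rewrite -ql1 e dot0v.
have aux l m F r k : k != 0 -> dot q l = k -> F = q + r *: cross l m ->
    cross l m != 0 ->
    <[cross l m]>%VS != <[F]>%VS /\ (<[q]> <= <[cross l m]> + <[F]>)%VS.
  move=> k0 ql -> lm; split; last first.
    rewrite -memvE -[q in q \in _](addrK (r *: cross l m)) addrC.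
    by rewrite memv_add ?memv_line // memvN memvZ // memv_line.
  apply: contraNneq k0 => e; have : (q + r *: cross l m) \in <[cross l m]>%VS.
    by rewrite e memv_line.
  move/vlineP=> [s] /(congr1 (dot l)).
  by rewrite dotC dotDl !dotZr dotZl ![dot (cross _ _) _]dotC dot_crossl !mulr0
    addr0 ql => ->.
have [n12 m12] := aux _ _ _ _ _ k1_neq0 ql1 e12 c12.
have [n13 m13] := aux _ _ _ _ _ k1_neq0 ql1 e13 c13.
have [n23 m23] := aux _ _ _ _ _ k2_neq0 ql2 e23 c23.
rewrite !kerl_cap //; split=> //.
- apply: triangle_det3; rewrite (_ : det3 _ _ _ = - det3 l1 l2 l3 ^+ 2).
    by rewrite oppr_eq0 expf_neq0.
  by vring.
- apply: triangle_det3; rewrite (_ : det3 _ _ _ = - det3 F12 F13 F23).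
    by rewrite oppr_eq0.
  by vring.
- by exists <[q]>%VS => //; apply/pointP; exists q.
Qed.

End Tiles.

(** * Subsets of the index set *)

Lemma cards_uniq3 (T : finType) (i j k : T) :
  uniq [:: i; j; k] -> #|[set i; j; k]| = 3%N.
Proof.
move=> /card_uniqP e; rewrite -[RHS]e; apply: eq_card => x.
by rewrite !inE -orbA.
Qed.

Lemma cards3P (T : finType) (I : {set T}) : #|I| = 3%N ->
  exists i j k, uniq [:: i; j; k] /\ I = [set i; j; k].
Proof.
move=> I3; have sz : size (enum I) = 3%N by rewrite -cardE.
have u := enum_uniq I; have mI x : (x \in I) = (x \in enum I).
  by rewrite mem_enum.
case: (enum I) sz u mI => [|i [|j [|k [|]]]] // _ u mI.
by exists i, j, k; split=> //; apply/setP=> x; rewrite mI !inE orbA.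
Qed.

Lemma lt_neq (i j : 'I_4) : (i < j)%N -> i != j.
Proof. by apply: contraTneq => ->; rewrite ltnn. Qed.

Lemma uniq3_lt (i j k : 'I_4) : (i < j < k)%N -> uniq [:: i; j; k].
Proof.
by case/andP=> ij jk; rewrite /= !inE negb_or andbT !lt_neq // (ltn_trans ij).
Qed.

Lemma uniq_extend (i j : 'I_4) : i != j -> exists l, uniq [:: i; j; l].
Proof.
move=> ij; have : [set i; j] != setT.
  by apply: contraTneq isT => /(congr1 (fun A : {set _} => #|A|));
    rewrite cards2 ij cardsT card_ord.
rewrite -subTset => /subsetPn[l _]; rewrite !inE negb_or => /andP[li lj].
by exists l; rewrite /= !inE negb_or ij ![_ == l]eq_sym li lj.
Qed.

Lemma uniq3E (i j l : 'I_4) : uniq [:: i; j; l] -> [/\ i != j, i != l & j != l].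
Proof. by rewrite /= !inE negb_or andbT => /andP[/andP[]]. Qed.

Lemma uniq4E (i j l m : 'I_4) : uniq [:: i; j; l; m] ->
  [/\ uniq [:: i; j; l], uniq [:: i; j; m], uniq [:: i; l; m]
    & uniq [:: j; l; m]].
Proof.
rewrite /= !inE !negb_or !andbT.
by case/and3P=> /and3P[-> -> ->] /andP[-> ->] ->.
Qed.

Lemma cards3_lt (I : {set 'I_4}) : #|I| = 3%N ->
  exists i j l : 'I_4, (i < j < l)%N /\ I = [set i; j; l].
Proof.
case/cards3P=> i [j [l [u ->]]]; have [ij il jl] := uniq3E u.
have pack (a b c : 'I_4) : (a < b)%N -> (b < c)%N ->
    (forall x, [|| x == i, x == j | x == l] = [|| x == a, x == b | x == c]) ->
    exists i' j' l' : 'I_4,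
    (i' < j' < l')%N /\ [set i; j; l] = [set i'; j'; l'].
  move=> ab bc e; exists a, b, c; rewrite ab bc; split=> //.
  by apply/setP=> x; have := e x; rewrite !inE !orbA.
have [lij|lji|/val_inj e] := ltngtP i j; last by rewrite e eqxx in ij.
all: have [lil|lli|/val_inj e] := ltngtP i l; last by rewrite e eqxx in il.
all: have [ljl|llj|/val_inj e] := ltngtP j l; last by rewrite e eqxx in jl.
- by apply: (pack i j l).
- apply: (pack i l j) => // x.
  by case: (x == i); case: (x == j); case: (x == l).
- by have := ltn_trans (ltn_trans lij ljl) lli; rewrite ltnn.
- apply: (pack l i j) => // x.
  by case: (x == i); case: (x == j); case: (x == l).
- apply: (pack j i l) => // x.
  by case: (x == i); case: (x == j); case: (x == l).
- by have := ltn_trans (ltn_trans llj lji) lil; rewrite ltnn.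
- apply: (pack j l i) => // x.
  by case: (x == i); case: (x == j); case: (x == l).
- apply: (pack l j i) => // x.
  by case: (x == i); case: (x == j); case: (x == l).
Qed.

Lemma cards_le2P (I : {set 'I_4}) : (#|I| <= 2)%N ->
  [\/ I = set0, exists i, I = [set i] | exists i j, i != j /\ I = [set i; j]].
Proof.
rewrite leq_eqVlt => /orP[/cards2P[i [j [ij ->]]]|].
  by apply: Or33; exists i, j.
rewrite ltnS leq_eqVlt ltnS leqn0 cards_eq0 => /orP[/cards1P[i ->]|/eqP->].
  by apply: Or32; exists i.
exact: Or31.
Qed.

Lemma other_ord (i : 'I_4) : exists j, i != j.
Proof.
exists (if i == ord0 then @Ordinal 4 1 isT else ord0).
by case: (boolP (i == ord0)) => [/eqP->|].
Qed.

Lemma cards0_le2 : (#|@set0 'I_4| <= 2)%N. Proof. by rewrite cards0. Qed.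

Lemma enum_set2 (i j : 'I_4) : i != j ->
  enum [set i; j] = [:: i; j] \/ enum [set i; j] = [:: j; i].
Proof.
move=> ij; have : perm_eq (enum [set i; j]) [:: i; j].
  apply: uniq_perm; rewrite ?enum_uniq //= ?inE ?ij // => x.
  by rewrite mem_enum !inE.
move=> p; have := perm_size p; have := perm_mem p; have := enum_uniq [set i; j].
case: (enum _) p => [|a [|b []]] //= p + e _; rewrite inE andbT => ab.
have := e a; have := e b; rewrite !inE !eqxx orbT /=.
case/esym/orP=> /eqP eb /esym/orP[]/eqP ea; subst a b;
  try by rewrite eqxx in ab.
  by right.
by left.
Qed.

Lemma card2_enum (I : {set 'I_4}) : #|I| = 2%N ->
  exists i j, [/\ i != j, I = [set i; j] & enum I = [:: i; j]].
Proof.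
move=> /eqP/cards2P[i [j [ij ->]]]; have [e|e] := enum_set2 ij.
  by exists i, j.
by exists j, i; rewrite eq_sym setUC; split=> //; rewrite setUC.
Qed.

(** * Coherent faces of a labelled cube *)

(** The label with coordinates [v] at a vertex of cardinality [n] of the
    cube. *)
Definition flat_of (K : fieldType) n (v : 'rV[K]_3) : flat K :=
  if odd n then kerl v else <[v]>%VS.

Lemma coherent_balanced (K : fieldType) (a b l m : 'rV[K]_3) (s t : K) :
  s != 0 -> t != 0 -> dot a l = s -> dot b l = s -> dot a m = t ->
  dot b m = t -> coherent <[a]>%VS (kerl l) <[b]>%VS (kerl m).
Proof.
move=> s0 t0 al bl am bm.
have nz (u v : 'rV[K]_3) (r : K) : r != 0 -> dot u v = r -> u != 0 /\ v != 0.
  by move=> r0 e; split; apply: contraNneq r0 => z; rewrite -e z ?dot0v ?dotv0.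
have [[a0 l0] [b0 m0]] := (nz _ _ _ s0 al, nz _ _ _ t0 bm).
by apply/coherentE => //; rewrite al bl am bm.
Qed.

Section Faces.
Variables (K : fieldType) (f : labelling K) (V : {set 'I_4} -> 'rV[K]_3).
Variable k : {set 'I_4} -> K.

(** An edge of the cube joins a point to a line, and the value on it is
    attached to the line, which is the end of odd cardinality. *)
Definition edge_value (I : {set 'I_4}) (i : 'I_4) :=
  dot (V I) (V (i |: I)) = k (if odd #|I| then I else i |: I).

(** With one value for each line, both sides of the equation in [coherentE]
    are the product of the values of the two lines. *)
Lemma coherent_face_balanced (I : {set 'I_4}) (i j : 'I_4) :
  i != j -> i \notin I -> j \notin I ->
  (forall J : {set 'I_4}, J \subset [set i; j] :|: I ->
     f J = flat_of #|J| (V J)) ->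
  (forall J, k J != 0) ->
  edge_value I i -> edge_value I j ->
  edge_value (i |: I) j -> edge_value (j |: I) i ->
  coherent_face f I i j.
Proof.
move=> ij iI jI fV k0; rewrite /edge_value !cardsU1 iI jI /= !add0n.
rewrite [j |: (i |: I)]setUCA => ei ej eij eji.
have fI := fV I (subsetUr _ _).
have fi : f (i |: I) = flat_of #|i |: I| (V (i |: I)).
  by apply: fV; rewrite setSU // sub1set !inE eqxx.
have fj : f (j |: I) = flat_of #|j |: I| (V (j |: I)).
  by apply: fV; rewrite setSU // sub1set !inE eqxx orbT.
have fij : f (i |: (j |: I)) = flat_of #|i |: (j |: I)| (V (i |: (j |: I))).
  by apply: fV; rewrite setUA.
have iJ : i \notin j |: I by rewrite !inE negb_or ij.
rewrite /coherent_face fI fi fj fij /flat_of !cardsU1 iI jI iJ /= !add0n.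
case: (odd _) ei ej eij eji => /= ei ej eij eji.
  by apply: (coherent_balanced (s := k (i |: (j |: I))) (t := k I));
    rewrite ?k0 // dotC.
by apply: (coherent_balanced (s := k (i |: I)) (t := k (j |: I)));
  rewrite ?k0 // dotC.
Qed.

End Faces.

(** * The cube theorem for normalized coordinates *)

Definition cube_property (K : fieldType) (f : labelling K) : Prop :=
  [/\ forall i j : 'I_4, (i < j)%N -> coherent_face f set0 i j,
      forall i j k : 'I_4, (i < j < k)%N ->
        [/\ perspective_at f i j k, exists! D : flat K, desargues_at f i j k D
          & forall D : flat K, desargues_at f i j k D <-> coherent_at f i j k D]
    & (forall i j k : 'I_4, (i < j < k)%N ->
         desargues_at f i j k (f [set i; j; k])) ->
      exists P : flat K,
        unique (concurrent_at f) P /\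
        unique (fun Q => coherent_cube (set_top f Q)) P].

Lemma coherentP (K : fieldType) (A l B m : flat K) : coherent A l B m ->
  is_point A /\ is_point B.
Proof. by case=> -[]. Qed.

Section Normalized.
Variables (K : fieldType) (f : labelling K) (V : {set 'I_4} -> 'rV[K]_3).
Variable k : 'I_4 -> K.

Local Notation F i j := (V [set i; j]).
Local Notation L i := (V [set i]).
Local Notation N i j l := (normal (F i j) (F i l) (F j l)).

Definition normalized :=
  [/\ forall I : {set 'I_4}, (#|I| <= 2)%N -> f I = flat_of #|I| (V I),
      forall i, k i != 0,
      forall i, dot (V set0) (L i) = k i
    & forall i j, i != j -> dot (F i j) (L i) = k i].

Definition general_position :=
  [/\ forall i j l, uniq [:: i; j; l] -> det3 (L i) (L j) (L l) != 0,
      forall i j l, uniq [:: i; j; l] -> det3 (F i j) (F i l) (F j l) != 0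
    & forall i j l m, uniq [:: i; j; l; m] ->
        det3 (N i j l) (N i j m) (N i l m) != 0].

Hypotheses (nV : normalized) (ndV : general_position).

Let fV (I : {set 'I_4}) : (#|I| <= 2)%N -> f I = flat_of #|I| (V I).
Proof. by case: nV => + _ _ _; apply. Qed.
Let k_neq0 i : k i != 0. Proof. by case: nV. Qed.
Let dot0L i : dot (V set0) (L i) = k i. Proof. by case: nV. Qed.
Let dotFl i j : i != j -> dot (F i j) (L i) = k i.
Proof. by case: nV => _ _ _; apply. Qed.
Let dotFr i j : i != j -> dot (F i j) (L j) = k j.
Proof. by move=> ij; rewrite setUC dotFl // eq_sym. Qed.
Let detL i j l : uniq [:: i; j; l] -> det3 (L i) (L j) (L l) != 0.
Proof. by case: ndV => + _ _; apply. Qed.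
Let detF i j l : uniq [:: i; j; l] -> det3 (F i j) (F i l) (F j l) != 0.
Proof. by case: ndV => _ + _; apply. Qed.
Let detN i j l m : uniq [:: i; j; l; m] ->
  det3 (N i j l) (N i j m) (N i l m) != 0.
Proof. by case: ndV => _ _; apply. Qed.

Lemma f1E i : f [set i] = kerl (L i).
Proof. by rewrite fV ?cards1. Qed.
Lemma f2E i j : i != j -> f [set i; j] = <[F i j]>%VS.
Proof. by move=> ij; rewrite fV cards2 ij. Qed.

(** F_ij - q is killed by the independent covectors l_i and l_j. *)
Lemma input_pointE i j : i != j ->
  exists r, F i j = V set0 + r *: cross (L i) (L j).
Proof.
move=> ij; have [l u] := uniq_extend ij.
have [c _ _] := det3_neq0 (detL u).
have [||r e] := dot_ortho2 (v := F i j - V set0) c.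
- by rewrite dotBl dotFl // dot0L subrr.
- by rewrite dotBl dotFr // dot0L subrr.
by exists r; rewrite -e addrC subrK.
Qed.

(** The scaled covectors of the Desargues lines. Indexing them by sets, and
    not by ordered triples, avoids the signs of [normal] under permutations. *)
Lemma exists_dual :
  exists n : {set 'I_4} -> 'rV[K]_3, forall (I : {set 'I_4}) i j,
    #|I| = 3%N -> i != j -> i \in I -> j \in I -> dot (F i j) (n I) = 1.
Proof.
suff /fin_all_exists[n nP] : forall I : {set 'I_4}, exists n, forall i j,
    #|I| = 3%N -> i != j -> i \in I -> j \in I -> dot (F i j) n = 1.
  by exists n.
move=> I.
have [/eqP/cards3P[a [b [c [u ->]]]]|I3] := boolP (#|I| == 3%N); last first.
  by exists 0 => i j e; rewrite e eqxx in I3.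
set d := det3 (F a b) (F a c) (F b c); exists (d^-1 *: N a b c) => i j _.
have d0 : d != 0 by apply: detF.
have [h1 h2 h3] : [/\ dot (F a b) (d^-1 *: N a b c) = 1,
    dot (F a c) (d^-1 *: N a b c) = 1 & dot (F b c) (d^-1 *: N a b c) = 1].
  by rewrite !dotZr dot_normal1 dot_normal2 dot_normal3 -/d mulVf.
move=> ij; rewrite !inE -!orbA.
move=> /or3P[]/eqP ei /or3P[]/eqP ej; move: ij; rewrite ei ej ?eqxx // => _.
all: by rewrite setUC.
Qed.

Lemma dualE i j l n : uniq [:: i; j; l] -> dot (F i j) n = 1 ->
  dot (F i l) n = 1 -> dot (F j l) n = 1 ->
  n = (det3 (F i j) (F i l) (F j l))^-1 *: N i j l.
Proof.
move=> u n1 n2 n3; have d0 := detF u; apply/eqP; rewrite -subr_eq0; apply/eqP.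
by apply: (det3_ortho d0); rewrite dotC dotBr dotZr ?n1 ?n2 ?n3
  ?dot_normal1 ?dot_normal2 ?dot_normal3 mulVf // subrr.
Qed.

Variable n : {set 'I_4} -> 'rV[K]_3.
Hypothesis nP : forall (I : {set 'I_4}) i j,
    #|I| = 3%N -> i != j -> i \in I -> j \in I -> dot (F i j) (n I) = 1.

Lemma dual_values i j l : uniq [:: i; j; l] ->
  [/\ dot (F i j) (n [set i; j; l]) = 1, dot (F i l) (n [set i; j; l]) = 1
    & dot (F j l) (n [set i; j; l]) = 1].
Proof.
move=> u; have [ij il jl] := uniq3E u.
by split; apply: nP; rewrite ?cards_uniq3 // !inE eqxx ?orbT.
Qed.

Lemma dual_normalE i j l : uniq [:: i; j; l] ->
  n [set i; j; l] = (det3 (F i j) (F i l) (F j l))^-1 *: N i j l.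
Proof. by move=> u; have [] := dual_values u; apply: dualE. Qed.

Lemma duals_free i j l m : uniq [:: i; j; l; m] ->
  det3 (n [set i; j; l]) (n [set i; j; m]) (n [set i; l; m]) != 0.
Proof.
move=> u; have [u1 u2 u3 u4] := uniq4E u.
rewrite !dual_normalE // det3ZZZ !mulf_eq0 !invr_eq0 !negb_or !detF //.
exact: detN.
Qed.

(** [cox], with each plane equation scaled to take the value 1. *)
Lemma cox_point i j l m : uniq [:: i; j; l; m] ->
  exists P, [/\ dot P (n [set i; j; l]) = 1, dot P (n [set i; j; m]) = 1,
                dot P (n [set i; l; m]) = 1 & dot P (n [set j; l; m]) = 1].
Proof.
move=> u; have [u1 u2 u3 u4] := uniq4E u.
have [ij il jl] := uniq3E u1; have [_ im jm] := uniq3E u2.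
have [_ _ lm] := uniq3E u3.
have [r1 e1] := input_pointE ij; have [r2 e2] := input_pointE il.
have [r3 e3] := input_pointE im; have [r4 e4] := input_pointE jl.
have [r5 e5] := input_pointE jm; have [r6 e6] := input_pointE lm.
have [P [P1 P2 P3 P4]] := cox e1 e2 e3 e4 e5 e6 (detN u).
exists P; rewrite !dual_normalE // !dotZr P1 P2 P3 P4.
by rewrite !mulVf ?detF.
Qed.

(** The common value of each line on its neighbours: [k i] on f_i, and 1 on
    the Desargues lines. *)
Definition edge_unit (J : {set 'I_4}) : K :=
  if [pick i | J == [set i]] is Some i then k i else 1.

Lemma edge_unit1 i : edge_unit [set i] = k i.
Proof.
rewrite /edge_unit; case: pickP => [j|/(_ i)]; last by rewrite eqxx.
by rewrite (inj_eq set1_inj) => /eqP->.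
Qed.

Lemma edge_unit3 (J : {set 'I_4}) : #|J| = 3%N -> edge_unit J = 1.
Proof.
rewrite /edge_unit; case: pickP => // i /eqP->.
by rewrite cards1.
Qed.

Lemma edge_unit_neq0 J : edge_unit J != 0.
Proof. by rewrite /edge_unit; case: pickP => // _; apply: oner_neq0. Qed.

(** Coordinates for all the vertices of the cube. The inputs and the
    Desargues lines are given, and [P] is the candidate for the top vertex. *)
Definition extend P (I : {set 'I_4}) :=
  if (#|I| <= 2)%N then V I else if #|I| == 3%N then n I else P.

Lemma extend_edge P (I : {set 'I_4}) i : i \notin I ->
  (#|I| = 3%N -> dot P (n I) = 1) -> edge_value (extend P) edge_unit I i.
Proof.
move=> iI IP; rewrite /edge_value /extend cardsU1 iI add1n.
case: (boolP (#|I| == 0%N)) => [|I0].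
  by rewrite cards_eq0 => /eqP->; rewrite cards0 /= setU0 edge_unit1 dot0L.
case: (boolP (#|I| == 1%N)) => [/cards1P[j e]|I1].
  rewrite e cards1 /= edge_unit1 dotC dotFr //.
  by apply: contraNneq iI => ->; rewrite e set11.
case: (boolP (#|I| == 2%N)) => [/cards2P[j [l [jl e]]]|I2].
  have I3 : #|i |: I| = 3%N by rewrite cardsU1 iI e cards2 jl.
  rewrite e cards2 jl /= -e edge_unit3 // e.
  by apply: nP; rewrite -?e // e !inE eqxx ?orbT.
have I3 : #|I| = 3%N.
  have := max_card (mem (i |: I)); rewrite card_ord cardsU1 iI.
  by case: #|I| I0 I1 I2 => [|[|[|[|]]]].
by rewrite I3 /= dotC IP // edge_unit3.
Qed.

Lemma face0 i j : i != j -> coherent_face f set0 i j.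
Proof.
move=> ij.
apply: (coherent_face_balanced (V := extend 0) (k := edge_unit)) => //;
  rewrite ?inE //; try exact: edge_unit_neq0.
- move=> J; rewrite setU0 => /subset_leq_card; rewrite cards2 ij => J2.
  by rewrite /extend J2 fV.
- by apply: extend_edge; rewrite ?inE ?cards0.
- by apply: extend_edge; rewrite ?inE ?cards0.
- by apply: extend_edge; rewrite ?inE ?setU0 ?cards1 // eq_sym orbF.
- by apply: extend_edge; rewrite ?inE ?setU0 ?cards1 // orbF.
Qed.

Lemma desargues_atE i j l D : uniq [:: i; j; l] ->
  desargues_at f i j l D <-> D = kerl (n [set i; j; l]).
Proof.
move=> u; have [ij il jl] := uniq3E u; have [n1 n2 n3] := dual_values u.
rewrite /desargues_at !f1E !f2E //.
by apply: (desargues_unique (k1 := k i) (k2 := k j) (k3 := k l));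
  rewrite ?dotFl ?dotFr ?detF.
Qed.

Lemma triple_property i j l : uniq [:: i; j; l] ->
  [/\ perspective_at f i j l, exists! D : flat K, desargues_at f i j l D
    & forall D : flat K, desargues_at f i j l D <-> coherent_at f i j l D].
Proof.
move=> u; have [ij il jl] := uniq3E u.
have [r1 e1] := input_pointE ij; have [r2 e2] := input_pointE il.
have [r3 e3] := input_pointE jl; split.
- rewrite /perspective_at !f1E !f2E //.
  by apply: (perspective_from (k1 := k i) (k2 := k j) (k3 := k l) _ _ _ _ _ _
    e1 e2 e3); rewrite ?detL ?detF.
- exists (kerl (n [set i; j; l])); split=> [|D]; first exact/desargues_atE.
  by move/desargues_atE => ->.
- move=> D; rewrite /desargues_at /coherent_at !f1E !f2E //.
  by apply: (coherent_desargues (k1 := k i) (k2 := k j) (k3 := k l));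
    rewrite ?dotFl ?dotFr ?detF.
Qed.

Hypothesis f3E : forall I : {set 'I_4}, #|I| = 3%N -> f I = kerl (n I).
Variable P : 'rV[K]_3.
Hypothesis nP1 : forall I : {set 'I_4}, #|I| = 3%N -> dot P (n I) = 1.

Lemma cube_P : coherent_cube (set_top f <[P]>%VS).
Proof.
move=> I i j ij iI jI; have neq_ij := lt_neq ij.
apply: (coherent_face_balanced (V := extend P) (k := edge_unit)) => //;
  try exact: edge_unit_neq0.
- move=> J _; rewrite /set_top /extend.
  case: eqP => [->|/eqP JT]; first by rewrite cardsT card_ord.
  case: leqP => [/fV //|J2].
  have J3 : #|J| = 3%N.
    have /proper_card : J \proper setT by rewrite properT.
    by rewrite cardsT card_ord => J4; apply/eqP; rewrite eqn_leq J2 andbT.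
  by rewrite J3 f3E.
all: apply: extend_edge; rewrite // ?inE ?negb_or ?iI ?jI ?andbT //.
- exact: nP1.
- exact: nP1.
- by rewrite eq_sym.
- exact: nP1.
- exact: nP1.
Qed.

Lemma duals_cross i j l m : uniq [:: i; j; l; m] ->
  cross (n [set i; j; l]) (n [set i; j; m]) != 0.
Proof. by move=> u; have [] := det3_neq0 (duals_free u). Qed.

(** A vector [u] with a common value s on the covectors of three independent
    Desargues lines differs from s P by a vector killed by all three. *)
Lemma top_unique Q : is_point Q ->
  (forall u, Q = <[u]>%VS -> forall i j l m, uniq [:: i; j; l; m] ->
     dot u (n [set i; j; l]) = dot u (n [set i; j; m])) -> Q = <[P]>%VS.
Proof.
case/pointP=> u u0 -> /(_ u erefl) h.
pose o i (lt : (i < 4)%N) : 'I_4 := Ordinal lt.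
pose a := o 0%N isT; pose b := o 1%N isT.
pose c := o 2%N isT; pose d := o 3%N isT.
have uabcd : uniq [:: a; b; c; d] by [].
have e1 := h a b c d isT; have e2 := h a c b d isT.
rewrite [[set a; c; b]]setUAC in e2.
have /subr0_eq eP : u - dot u (n [set a; b; c]) *: P = 0.
  apply: (det3_ortho (duals_free uabcd));
    rewrite dotBl dotZl nP1 ?cards_uniq3 //.
  - by rewrite mulr1 subrr.
  - by rewrite mulr1 e1 subrr.
  - by rewrite mulr1 e2 subrr.
have s0 : dot u (n [set a; b; c]) != 0.
  by apply: contraNneq u0 => e; rewrite eP e scale0r.
have P0 : P != 0 by apply: contraNneq u0 => e; rewrite eP e scaler0.
apply/eqP; rewrite vline_eq // eP.
by rewrite -[X in cross _ X]scale1r crossZZ crossvv scaler0.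
Qed.

Lemma P_neq0 : P != 0.
Proof.
have I3 : #|~: [set ord0 : 'I_4]| = 3%N by rewrite cardsC1 card_ord.
by apply: contraTneq (oner_neq0 K) => e; rewrite -(nP1 I3) e dot0v eqxx.
Qed.

(** Since both Desargues covectors take the value 1 on F_ij, the line through
    f_ij and the intersection of the two Desargues lines has as covector the
    difference of theirs. *)
Lemma join_meet i j l m : uniq [:: i; j; l; m] ->
  let X := (f [set i; j; l] :&: f [set i; j; m])%VS in
  [/\ is_point X, is_line (f [set i; j] + X)%VS
    & forall u, (<[u]> <= f [set i; j] + X)%VS
        = (dot u (n [set i; j; l]) == dot u (n [set i; j; m]))].
Proof.
move=> u; have [u1 u2 _ _] := uniq4E u; have [ij _ _] := uniq3E u1.
have nn := duals_cross u.
have [n1 _ _] := dual_values u1; have [n2 _ _] := dual_values u2.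
rewrite /= (f3E (cards_uniq3 u1)) (f3E (cards_uniq3 u2)) kerl_cap // f2E //.
have e : cross (F i j) (cross (n [set i; j; l]) (n [set i; j; m]))
         = n [set i; j; l] - n [set i; j; m].
  by rewrite cross_cross n1 n2 !scale1r.
have e0 : n [set i; j; l] - n [set i; j; m] != 0.
  by apply: contraNneq nn => /subr0_eq->; rewrite crossvv.
rewrite vline_addv e //; split=> [||v].
- by apply/pointP; eexists; first exact: nn.
- by apply/lineP; exists (n [set i; j; l] - n [set i; j; m]).
- by rewrite vline_kerl dotBr subr_eq0.
Qed.

Lemma concurrent_P : concurrent_at f <[P]>%VS.
Proof.
split; first by apply/pointP; exists P; rewrite ?P_neq0.
move=> i j l m u; have [u1 u2 _ _] := uniq4E u; have [X1 X2 X3] := join_meet u.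
by split=> //; rewrite X3 !nP1 ?cards_uniq3.
Qed.

Lemma concurrent_unique Q : concurrent_at f Q -> Q = <[P]>%VS.
Proof.
case=> Qp Qc; apply: top_unique Qp _ => v eQ i j l m u.
have [_ _] := Qc _ _ _ _ u; have [_ _ h] := join_meet u.
by rewrite eQ h => /eqP.
Qed.

Lemma set_top_small Q (J : {set 'I_4}) : (#|J| < 4)%N -> set_top f Q J = f J.
Proof.
by rewrite /set_top; case: eqP => // ->; rewrite cardsT card_ord.
Qed.

Lemma top_face Q (i j l m : 'I_4) : coherent_cube (set_top f Q) ->
  uniq [:: i; j; l; m] -> (l < m)%N ->
  coherent <[F i j]>%VS (kerl (n [set i; j; l])) Q (kerl (n [set i; j; m])).
Proof.
move=> cQ u lm; have [u1 u2 u3 _] := uniq4E u; have [ij il jl] := uniq3E u1.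
have [_ im jm] := uniq3E u2; have [_ _ lm'] := uniq3E u3.
have lI : l \notin [set i; j] by rewrite !inE negb_or ![l == _]eq_sym il.
have mI : m \notin [set i; j] by rewrite !inE negb_or ![m == _]eq_sym im.
have := cQ _ _ _ lm lI mI; rewrite /coherent_face cards2 ij /=.
have -> : l |: (m |: [set i; j]) = setT.
  have lJ : l \notin m |: [set i; j] by rewrite in_setU1 negb_or lm' lI.
  apply/eqP; rewrite eqEcard subsetT cardsT card_ord.
  by rewrite cardsU1 (cardsU1 m) lJ mI cards2 ij.
rewrite [set_top f Q setT]/set_top eqxx.
rewrite !set_top_small ?(cardsU1 l) ?(cardsU1 m) ?lI ?mI ?cards2 ?ij //.
rewrite ![_ |: [set i; j]]setUC (f3E (cards_uniq3 u1)) (f3E (cards_uniq3 u2)).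
by rewrite f2E.
Qed.

Lemma cube_unique Q : coherent_cube (set_top f Q) -> Q = <[P]>%VS.
Proof.
move=> cQ; have Qp : is_point Q.
  pose o i (lt : (i < 4)%N) : 'I_4 := Ordinal lt.
  have := @top_face Q (o 0%N isT) (o 1%N isT) (o 2%N isT) (o 3%N isT)
    cQ isT isT.
  by case/coherentP.
apply: (top_unique Qp) => v eQ i j l m.
have v0 : v != 0 by move: Qp; rewrite eQ /is_point dim_vline eqb1.
wlog lm : l m / (l < m)%N.
  move=> wl u; have [_ _ u3 _] := uniq4E u; have [_ _ lm] := uniq3E u3.
  have [lt|lt|/val_inj e] := ltngtP l m; first exact: wl.
    apply/esym/wl => //; rewrite (perm_uniq (s2 := [:: i; j; l; m])) //.
    by rewrite !perm_cons (permEl (perm_catC [:: m] [:: l])).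
  by rewrite e eqxx in lm.
move=> u; have [u1 u2 _ _] := uniq4E u.
have [n1 _ _] := dual_values u1; have [n2 _ _] := dual_values u2.
have nz (J : {set 'I_4}) : dot (F i j) (n J) = 1 -> F i j != 0 /\ n J != 0.
  move=> e; split; apply: contraTneq (oner_neq0 K) => z.
    by rewrite -e z dot0v eqxx.
  by rewrite -e z dotv0 eqxx.
have [F0 l0] := nz _ n1; have [_ m0] := nz _ n2.
have := top_face cQ u lm; rewrite eQ => /coherentE[] // _ _.
by rewrite n1 n2 mul1r mulr1.
Qed.

End Normalized.

Lemma normalized_cube_property (K : fieldType) (f : labelling K) V k :
  normalized f V k -> general_position V -> cube_property f.
Proof.
move=> nV ndV; have [n nP] := exists_dual ndV; split.
- by move=> i j ij; apply: (face0 nV nP); apply: lt_neq.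
- by move=> i j l /uniq3_lt; apply: (triple_property nV ndV nP).
move=> fD; have f3E (I : {set 'I_4}) : #|I| = 3%N -> f I = kerl (n I).
  case/cards3_lt=> i [j [l [ijl ->]]].
  exact: ((desargues_atE nV ndV nP _ (uniq3_lt ijl)).1 (fD _ _ _ ijl)).
have [P nP1] : exists P, forall I : {set 'I_4}, #|I| = 3%N -> dot P (n I) = 1.
  pose o i (lt : (i < 4)%N) : 'I_4 := Ordinal lt.
  have [P [P1 P2 P3 P4]] := @cox_point _ _ _ _ nV ndV _ nP
    (o 0%N isT) (o 1%N isT) (o 2%N isT) (o 3%N isT) isT.
  exists P => I /cards3_lt[[i lti] [[j ltj] [[l ltl] [/= ijl ->]]]].
  case: i lti ijl => [|[|[|[|i]]]] // lti; case: j ltj => [|[|[|[|j]]]] // ltj;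
    case: l ltl => [|[|[|[|l]]]] // ltl _.
  - by rewrite -[RHS]P1; congr (dot P (n [set _; _; _])); apply: val_inj.
  - by rewrite -[RHS]P2; congr (dot P (n [set _; _; _])); apply: val_inj.
  - by rewrite -[RHS]P3; congr (dot P (n [set _; _; _])); apply: val_inj.
  - by rewrite -[RHS]P4; congr (dot P (n [set _; _; _])); apply: val_inj.
exists <[P]>%VS; split; split.
- exact: (concurrent_P nV ndV nP f3E nP1).
- by move=> Q cQ; rewrite (concurrent_unique nV ndV nP f3E nP1 cQ).
- exact: (cube_P nV nP f3E nP1).
- by move=> Q cQ; rewrite (cube_unique nV ndV nP f3E nP1 cQ).
Qed.

(** * Admissible inputs in coordinates *)

Section InputSpace.
Variable K : fieldType.
Implicit Types (f : labelling K) (C : {set 'I_4} -> 'rV[K]_3).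

(** The pairing form of coherence says that f_ij is on the line with covector
    (q.m) l - (q.l) m, which is the line joining f to the intersection of l
    and m. *)
Lemma coherent_input_space f :
  (forall i j : 'I_4, (i < j)%N -> f [set i] != f [set j]) ->
  (forall i j : 'I_4, (i < j)%N -> coherent_face f set0 i j) ->
  input_space f.
Proof.
move=> neq coh.
have tile (i j : 'I_4) : (i < j)%N ->
    coherent (f set0) (f [set i]) (f [set i; j]) (f [set j]).
  by move=> /coh; rewrite /coherent_face cards0 /= !setU0.
split.
- by case: (tile (@Ordinal 4 0 isT) (@Ordinal 4 1 isT) isT) => -[].
- move=> i; have [i0|i0] := posnP i.
    by case: (tile i (@Ordinal 4 1 isT)) => [|[]]; rewrite ?i0.
  by case: (tile (@Ordinal 4 0 isT) i i0) => -[].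
move=> i j ij; have := tile i j ij; have := neq i j ij => {neq tile coh}.
move=> nf coh; have [[]] := coh.
move=> /pointP[q q0 eq] /lineP[l l0 el] /pointP[b b0 eb] /lineP[m m0 em] _ _ _.
rewrite eq el eb em in coh nf *; have lm : cross l m != 0 by rewrite -kerl_eq.
have /coherentE[] // := coh => -[ql qm] [bl bm] e.
rewrite /= kerl_cap //; split=> //.
- apply: contraNneq ql => e'; have : q \in <[cross l m]>%VS.
    by rewrite -e' memv_line.
  case/vlineP=> r ->.
  by rewrite dotZl dotC dot_crossl mulr0.
- by apply/pointP; exists b.
have d : cross q (cross l m) = dot q m *: l - dot q l *: m.
  by rewrite cross_cross.
rewrite vline_addv ?vline_kerl ?d.
  by rewrite dotBr !dotZr e [X in X - _]mulrC subrr.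
apply: contraNneq ql => e'; have := congr1 (cross l) e'.
have -> r s : cross l (r *: l - s *: m) = - s *: cross l m by vring.
by rewrite crossv0 => /eqP; rewrite scaler_eq0 oppr_eq0 (negPf lm) orbF.
Qed.

(** [input_space] in coordinates. *)
Definition admissible C := forall i j : 'I_4, i != j ->
  [/\ cross (C set0) (cross (C [set i]) (C [set j])) != 0,
      C [set i; j] != 0
    & dot (C [set i; j]) (cross (C set0) (cross (C [set i]) (C [set j]))) = 0].

Definition coordinates C f := forall I : {set 'I_4}, (#|I| <= 2)%N ->
  C I != 0 /\ f I = flat_of #|I| (C I).

Lemma admissible_neq0 C (I : {set 'I_4}) :
  admissible C -> (#|I| <= 2)%N -> C I != 0.
Proof.
move=> vC /cards_le2P[->|[i ->]|[i [j [ij ->]]]].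
- have [j ij] := other_ord ord0.
  by have [/cross_neq0l] := vC _ _ ij.
- have [j ij] := other_ord i.
  by have [/cross_neq0r/cross_neq0l] := vC _ _ ij.
- by have [] := vC _ _ ij.
Qed.

Lemma admissible_input_space C f : admissible C ->
  (forall I : {set 'I_4}, (#|I| <= 2)%N -> f I = flat_of #|I| (C I)) ->
  input_space f.
Proof.
move=> vC fC.
have fi (i : 'I_4) : f [set i] = kerl (C [set i]) by rewrite fC ?cards1.
have Ci0 (i : 'I_4) : C [set i] != 0 by apply: admissible_neq0; rewrite ?cards1.
have q0 : C set0 != 0 by apply: admissible_neq0; rewrite ?cards0.
split=> [|i|i j lt_ij].
- by apply/pointP; exists (C set0); rewrite ?fC ?cards0.
- by apply/lineP; exists (C [set i]).
have ij := lt_neq lt_ij.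
have [qX F0 FqX] := vC _ _ ij; have X0 := cross_neq0r qX.
rewrite /= !fi kerl_cap // kerl_eq // X0 !fC ?cards0 ?cards2 ?ij //=.
rewrite /flat_of /= vline_eq // qX vline_addv // vline_kerl FqX eqxx.
by split=> //; apply/pointP; exists (C [set i; j]).
Qed.

Lemma coordinates_admissible C f :
  input_space f -> coordinates C f -> admissible C.
Proof.
case=> _ _ h fC.
have fC1 (i : 'I_4) : C [set i] != 0 /\ f [set i] = kerl (C [set i]).
  by have := fC [set i]; rewrite cards1 => /(_ isT).
have lt (i j : 'I_4) : (i < j)%N ->
  [/\ cross (C set0) (cross (C [set i]) (C [set j])) != 0,
      C [set i; j] != 0
    & dot (C [set i; j]) (cross (C set0) (cross (C [set i]) (C [set j]))) = 0].
  move=> lt_ij; have ij := lt_neq lt_ij.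
  have := h _ _ lt_ij; have [q0 ->] := fC _ cards0_le2.
  have [[li0 ->] [lj0 ->]] := (fC1 i, fC1 j).
  have [F0 ->] : C [set i; j] != 0 /\ f [set i; j] = <[C [set i; j]]>%VS.
    by have := fC [set i; j]; rewrite cards2 ij => /(_ isT).
  rewrite cards0 /flat_of /= kerl_eq // => -[X0].
  by rewrite kerl_cap // vline_eq // => qX _; rewrite vline_addv // vline_kerl
    => /eqP.
move=> i j; rewrite -(inj_eq val_inj) neq_ltn => /orP[/lt//|/lt[h1 h2 h3]].
have e : cross (C [set i]) (C [set j]) = - cross (C [set j]) (C [set i]).
  exact: crossC.
have crossN u v : cross u (- v) = - cross u v :> 'rV[K]_3 by vring.
rewrite e crossN oppr_eq0 [[set i; j]]setUC; split=> //.
by rewrite -scaleN1r dotZr h3 mulr0.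
Qed.

Lemma line_coordE (w : 'rV[K]_3) (l : flat K) :
  line_coord w l <-> w != 0 /\ l = kerl w.
Proof.
have e (v : 'rV[K]_3) : (v *m w^T == 0) = (dot v w == 0).
  by rewrite -mem_kerl memv_ker lfunE.
split=> -[w0 h]; split=> //.
  by apply/vspaceP=> v; rewrite h e mem_kerl.
by move=> v; rewrite h e mem_kerl.
Qed.

(** Coordinates are given on the type of index sets with at most two
    elements; composing with this retraction extends them to all index sets. *)
Definition to_input (I : {set 'I_4}) : input :=
  insubd (exist _ set0 cards0_le2) I.

End InputSpace.

(** * The nondegeneracy polynomial *)

Section Nondegeneracy.
Variable R : comNzRingType.
Implicit Type C : {set 'I_4} -> 'rV[R]_3.

Definition slope C (e : 'I_4 * 'I_4) : R :=
  dot (C [set e.1; e.2]) (C [set e.1]).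

(** The vector of f_ij scaled to pair with l_i to the value (q.l_i) B, where
    B is the product of all the slopes ([dot_scaled]). Multiplying by the
    other slopes, instead of dividing by this one, keeps the expression
    polynomial. *)
Definition scaled C i j : 'rV[R]_3 :=
  (dot (C set0) (C [set i])
   * \prod_(e : 'I_4 * 'I_4 | (e.1 != e.2) && (e != (i, j))) slope C e)
  *: C [set i; j].

Definition face_normal C i j l :=
  normal (scaled C i j) (scaled C i l) (scaled C j l).

Definition line_condition C (t : 'I_4 * 'I_4 * 'I_4) :=
  det3 (C [set t.1.1]) (C [set t.1.2]) (C [set t.2]).

Definition point_condition C (t : 'I_4 * 'I_4 * 'I_4) :=
  det3 (scaled C t.1.1 t.1.2) (scaled C t.1.1 t.2) (scaled C t.1.2 t.2).

Definition plane_condition C (t : 'I_4 * 'I_4 * 'I_4 * 'I_4) :=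
  det3 (face_normal C t.1.1.1 t.1.1.2 t.1.2)
       (face_normal C t.1.1.1 t.1.1.2 t.2)
       (face_normal C t.1.1.1 t.1.2 t.2).

(** The nonvanishing of this single product collects every genericity
    condition: the points f and f_ij are off the lines f_i, no three of these
    lines are concurrent, the points f_ij, f_ik, f_jk are not collinear and
    no three Desargues lines have a common point. It is defined over any
    ring, so that it can be evaluated at indeterminates and commutes with
    specialization ([nondegeneracy_map]). *)
Definition nondegeneracy C : R :=
  \prod_i dot (C set0) (C [set i])
  * \prod_(e : 'I_4 * 'I_4 | e.1 != e.2) slope C e
  * \prod_(t | uniq [:: t.1.1; t.1.2; t.2]) line_condition C t
  * \prod_(t | uniq [:: t.1.1; t.1.2; t.2]) point_condition C t
  * \prod_(t | uniq [:: t.1.1.1; t.1.1.2; t.1.2; t.2]) plane_condition C t.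

End Nondegeneracy.

Section Morphism.
Variables (R S : comNzRingType) (h : {rmorphism R -> S}).
Implicit Types (u v w : 'rV[R]_3) (C : {set 'I_4} -> 'rV[R]_3).

Lemma dot_map u v : dot (map_mx h u) (map_mx h v) = h (dot u v).
Proof. by rewrite /dot !mxE !rmorphD !rmorphM. Qed.

Lemma cross_map u v : cross (map_mx h u) (map_mx h v) = map_mx h (cross u v).
Proof.
by apply: row3P; rewrite /cross /vec3 !mxE /= rmorphB !rmorphM.
Qed.

Lemma det3_map u v w :
  det3 (map_mx h u) (map_mx h v) (map_mx h w) = h (det3 u v w).
Proof. by rewrite /det3 cross_map dot_map. Qed.

Lemma normal_map u v w :
  normal (map_mx h u) (map_mx h v) (map_mx h w) = map_mx h (normal u v w).
Proof. by rewrite /normal -!map_mxB cross_map. Qed.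

Lemma slope_map C e : slope (map_mx h \o C) e = h (slope C e).
Proof. exact: dot_map. Qed.

Lemma scaled_map C i j : scaled (map_mx h \o C) i j = map_mx h (scaled C i j).
Proof.
rewrite /scaled map_mxZ rmorphM rmorph_prod /= dot_map.
by under eq_bigr do rewrite slope_map.
Qed.

Lemma face_normal_map C i j l :
  face_normal (map_mx h \o C) i j l = map_mx h (face_normal C i j l).
Proof. by rewrite /face_normal !scaled_map normal_map. Qed.

Lemma nondegeneracy_map C : nondegeneracy (map_mx h \o C) = h (nondegeneracy C).
Proof.
rewrite /nondegeneracy !rmorphM !rmorph_prod; congr (_ * _ * _ * _ * _);
  apply: eq_bigr => t _.
- exact: dot_map.
- exact: slope_map.
- exact: det3_map.
- by rewrite /point_condition !scaled_map det3_map.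
- by rewrite /plane_condition !face_normal_map det3_map.
Qed.

End Morphism.

Section Field.
Variable K : fieldType.
Implicit Types (f : labelling K) (C : {set 'I_4} -> 'rV[K]_3).

Definition base_weight C := \prod_(e : 'I_4 * 'I_4 | e.1 != e.2) slope C e.

(** Only the unordered pair matters at a two-element set, by [scaledC]. *)
Definition normalize C (I : {set 'I_4}) : 'rV[K]_3 :=
  match enum I with
  | [::] => base_weight C *: C set0
  | [:: i] => C [set i]
  | i :: j :: _ => scaled C i j
  end.

Lemma normalize0 C : normalize C set0 = base_weight C *: C set0.
Proof. by rewrite /normalize enum_set0. Qed.

Lemma normalize1 C i : normalize C [set i] = C [set i].
Proof. by rewrite /normalize enum_set1. Qed.

Section Normalize.
Variable C : {set 'I_4} -> 'rV[K]_3.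
Hypotheses (vC : admissible C) (ndC : nondegeneracy C != 0).

Let nondegeneracy_factors :
  [/\ forall i, dot (C set0) (C [set i]) != 0,
      forall i j, i != j -> slope C (i, j) != 0,
      forall i j l, uniq [:: i; j; l] -> line_condition C (i, j, l) != 0,
      forall i j l, uniq [:: i; j; l] -> point_condition C (i, j, l) != 0
    & forall i j l m, uniq [:: i; j; l; m] ->
        plane_condition C (i, j, l, m) != 0].
Proof.
have := ndC; rewrite !mulf_eq0 !negb_or -!andbA.
case/and5P=> /prodf_neq0 h1 /prodf_neq0 h2 /prodf_neq0 h3 /prodf_neq0 h4.
move=> /prodf_neq0 h5; split.
- by move=> i; apply: h1.
- by move=> i j ij; apply: (h2 (i, j)).
- by move=> i j l u; apply: (h3 (i, j, l)).
- by move=> i j l u; apply: (h4 (i, j, l)).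
- by move=> i j l m u; apply: (h5 (i, j, l, m)).
Qed.

Let weight_split i j : i != j -> base_weight C = slope C (i, j) *
  \prod_(e : 'I_4 * 'I_4 | (e.1 != e.2) && (e != (i, j))) slope C e.
Proof. by move=> ij; rewrite /base_weight (bigD1 (i, j)). Qed.

Let dot_scaled i j : i != j ->
  dot (scaled C i j) (C [set i]) = dot (C set0) (C [set i]) * base_weight C.
Proof.
by move=> ij; rewrite (weight_split ij) /scaled dotZl -mulrA [_ * dot _ _]mulrC.
Qed.

Lemma base_weight_neq0 : base_weight C != 0.
Proof.
case: nondegeneracy_factors => _ s0 _ _ _.
by apply/prodf_neq0 => -[i j] /=; apply: s0.
Qed.

(** The incidence of f_ij with the line through f and the intersection of f_i
    and f_j is exactly the compatibility of the two scalings. *)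
Lemma scaledC i j : i != j -> scaled C i j = scaled C j i.
Proof.
move=> ij; have ji : j != i by rewrite eq_sym.
have [a0 s0 _ _ _] := nondegeneracy_factors.
have [_ _ inc] := vC ij; rewrite /scaled [[set j; i]]setUC; congr (_ *: _).
have sji : slope C (j, i) = dot (C [set i; j]) (C [set j]).
  by rewrite /slope /= setUC.
have e : dot (C set0) (C [set i]) * slope C (j, i)
       = dot (C set0) (C [set j]) * slope C (i, j).
  move: inc; rewrite cross_cross dotBr !dotZr -sji => /eqP.
  by rewrite subr_eq0 => /eqP<-.
apply: (mulIf (s0 _ _ ij)); apply: (mulIf (s0 _ _ ji)).
rewrite -!mulrA [slope C (i, j) * _ in RHS]mulrC !mulrA.
rewrite -[_ * _ * slope C (i, j)]mulrA -[in LHS](mulrC (slope C (i, j))).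
rewrite -(weight_split ij) -[_ * _ * slope C (j, i) in RHS]mulrA.
rewrite -[in RHS](mulrC (slope C (j, i))) -(weight_split ji).
by rewrite mulrAC e mulrAC.
Qed.

Lemma normalize2 i j : i != j -> normalize C [set i; j] = scaled C i j.
Proof.
move=> ij; rewrite /normalize.
by have [->|->] := enum_set2 ij; rewrite // scaledC // eq_sym.
Qed.

Lemma normalizeP f : coordinates C f ->
  normalized f (normalize C)
    (fun i => dot (C set0) (C [set i]) * base_weight C).
Proof.
have [a0 s0 _ _ _] := nondegeneracy_factors; have w0 := base_weight_neq0.
have scale a (v : 'rV[K]_3) : a != 0 -> v != 0 -> <[v]>%VS = <[a *: v]>%VS.
  move=> a_neq0 v0; apply/eqP; rewrite vline_eq ?scaler_eq0 ?negb_or ?a_neq0 //.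
  by rewrite -[v in cross v]scale1r crossZZ crossvv scaler0.
move=> fC; split=> [I I2|i|i|i j ij].
- have [C0 ->] := fC I I2.
  case/cards_le2P: I2 C0 => [->|[i ->]|[i [j [ij ->]]]] C0.
  + by rewrite normalize0 cards0; apply: scale.
  + by rewrite normalize1.
  rewrite cards2 ij normalize2 //; apply: scale => //; rewrite mulf_neq0 //.
  apply/prodf_neq0 => -[a b] /= /andP[ab _]; exact: s0.
- by rewrite mulf_neq0.
- by rewrite normalize0 normalize1 dotZl mulrC.
- by rewrite normalize1 normalize2 // dot_scaled.
Qed.

Lemma normalize_general : general_position (normalize C).
Proof.
have [_ _ h3 h4 h5] := nondegeneracy_factors; split.
- by move=> i j l u; rewrite !normalize1; apply: h3.
- move=> i j l u; have [ij il jl] := uniq3E u.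
  by rewrite !normalize2 //; apply: h4.
move=> i j l m u; have [u1 u2 u3 u4] := uniq4E u.
have [ij il jl] := uniq3E u1; have [_ im jm] := uniq3E u2.
have [_ _ lm] := uniq3E u3.
by rewrite !normalize2 //; apply: h5.
Qed.

End Normalize.

Lemma nondegeneracy_cube_property C f :
  input_space f -> coordinates C f -> nondegeneracy C != 0 -> cube_property f.
Proof.
move=> fin fC ndC; have vC := coordinates_admissible fin fC.
exact: normalized_cube_property (normalizeP vC ndC fC)
  (normalize_general vC ndC).
Qed.

End Field.

(** * Openness of the generic locus *)

Section Open.
Variable K : fieldType.
Implicit Types (f : labelling K) (c : input -> 'rV[K]_3).

Lemma val_to_input (I : {set 'I_4}) : (#|I| <= 2)%N -> val (to_input I) = I.
Proof. by move=> I2; rewrite /to_input val_insubd I2. Qed.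

Lemma to_input_val (J : input) : to_input (val J) = J.
Proof. exact: valKd. Qed.

Lemma input_coordE c f (J : input) : input_coord c f ->
  c J != 0 /\ f (val J) = flat_of #|val J| (c J).
Proof.
by move=> /(_ J); rewrite /flat_of; case: ifP => // _ /line_coordE.
Qed.

Lemma input_coord_coordinates c f :
  input_coord c f -> coordinates (c \o to_input) f.
Proof.
by move=> fc I I2; have := input_coordE (to_input I) fc; rewrite val_to_input.
Qed.

Lemma coordinates_input_coord C f : coordinates C f -> input_coord (C \o val) f.
Proof.
move=> fC J; have [C0 ->] := fC _ (valP J); rewrite /flat_of /=.
by case: (odd _); [apply/line_coordE|split].
Qed.

Lemma input_coord_exists f : input_space f -> exists c, input_coord c f.
Proof.
case=> f0 f1 f2; suff /fin_all_exists : forall J : input, exists v : 'rV[K]_3,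
    v != 0 /\ f (val J) = flat_of #|val J| v.
  move=> [c fc]; exists c => J; have [c0 ->] := fc J; rewrite /flat_of.
  by case: (odd _); [apply/line_coordE|split].
have pt (I : {set 'I_4}) : ~~ odd #|I| -> is_point (f I) ->
    exists v : 'rV[K]_3, v != 0 /\ f I = flat_of #|I| v.
  by rewrite /flat_of => /negPf-> /pointP[v]; exists v.
case=> I I2 /=; case/cards_le2P: {+}I2 => [->|[i ->]|[i [j [ij ->]]]].
- by apply: pt; rewrite ?cards0.
- by have /lineP[v] := f1 i; rewrite /flat_of cards1; exists v.
apply: pt; first by rewrite cards2 ij.
have /orP[/f2[] //|/f2[_ _ + _]] : (i < j)%N || (j < i)%N by rewrite -neq_ltn.
by rewrite setUC.
Qed.

Lemma input_coord_scale c c' f : input_coord c f -> input_coord c' f ->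
  exists2 lam : input -> K, forall J, lam J != 0
    & c' = fun J => lam J *: c J.
Proof.
move=> fc fc'.
suff /fin_all_exists[lam lamP] : forall J, exists r, r != 0 /\ c' J = r *: c J.
  exists lam => [J|]; first by case: (lamP J).
  by apply: functional_extensionality => J; case: (lamP J).
move=> J; have [c0 e] := input_coordE J fc.
have [c0' e'] := input_coordE J fc'; have cc' : cross (c J) (c' J) = 0.
  apply/eqP; have := e; rewrite e' /flat_of; case: ifP => _ /esym/eqP.
    by rewrite kerl_eq.
  by rewrite vline_eq.
have [r er] := cross_eq0 c0 cc'; exists r; split=> //.
by apply: contraNneq c0' => r0; rewrite er r0 scale0r.
Qed.

Definition generic_locus f : Prop :=
  input_space f
  /\ exists2 c, input_coord c f & nondegeneracy (c \o to_input) != 0.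

Definition nondegeneracy_poly (lam : input -> K) : {mpoly K[nvars]} :=
  nondegeneracy ((fun J : input =>
    \row_j ((lam J)%:MP * 'X_(enum_rank (J, j)))) \o to_input).

Lemma nondegeneracy_polyE lam c :
  (nondegeneracy_poly lam).@[flatten_coord c]
  = nondegeneracy ((fun J => lam J *: c J) \o to_input).
Proof.
rewrite /nondegeneracy_poly -[LHS]nondegeneracy_map; congr nondegeneracy.
apply: functional_extensionality => I.
apply/rowP=> j; rewrite /= !mxE mevalM mevalC mevalXU /flatten_coord.
by rewrite enum_rankK.
Qed.

(** The family of polynomials consists of all the rescalings of
    [nondegeneracy], so that its nonvanishing locus does not depend on the
    coordinates chosen. *)
Lemma generic_locus_open : zariski_open generic_locus.
Proof.
split=> [f []//|].
exists (fun p =>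
  exists2 lam, forall J, lam J != 0 & p = nondegeneracy_poly lam) => f c fin fc.
split=> [[_ [c' fc' nd']]|[p [lam lam0 ->] ndp]].
  have [lam lam0 e] := input_coord_scale fc fc'.
  exists (nondegeneracy_poly lam); first by exists lam.
  by rewrite nondegeneracy_polyE -e.
split=> //; exists (fun J => lam J *: c J); last first.
  by rewrite -nondegeneracy_polyE.
move=> J; have [c0 ->] := input_coordE J fc.
have lc0 : lam J *: c J != 0 by rewrite scaler_eq0 negb_or lam0.
have e : cross (c J) (lam J *: c J) = 0.
  by rewrite -[X in cross X]scale1r crossZZ crossvv scaler0.
rewrite /flat_of; case: (odd _).
  by apply/line_coordE; split=> //; apply/eqP; rewrite kerl_eq ?e.
by split=> //; apply/eqP; rewrite vline_eq ?e.
Qed.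

Lemma generic_locus_cube_property f : generic_locus f -> cube_property f.
Proof.
case=> fin [c fc].
exact: nondegeneracy_cube_property fin (input_coord_coordinates fc).
Qed.

End Open.

(** * A polynomial parametrization of the input space *)

Section Parametrization.
Variable R : comNzRingType.

(** The input space is the image of an open subset of an affine space: a
    point p, four lines, and for each pair of lines the two coefficients of
    f_ij on p and on the intersection of the lines. The orientation of the
    pair, given by the enumeration of the set, only affects the sign of the
    second coefficient. *)
Definition config (p : 'rV[R]_3) (l : 'I_4 -> 'rV[R]_3)
    (s t : {set 'I_4} -> R) (I : {set 'I_4}) : 'rV[R]_3 :=
  match enum I with
  | [::] => p
  | [:: i] => l i
  | i :: j :: _ => s I *: p + t I *: cross (l i) (l j)
  end.

Lemma config0 p l s t : config p l s t set0 = p.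
Proof. by rewrite /config enum_set0. Qed.

Lemma config1 p l s t i : config p l s t [set i] = l i.
Proof. by rewrite /config enum_set1. Qed.

Lemma config_incident p l s t (i j : 'I_4) : i != j ->
  dot (config p l s t [set i; j]) (cross p (cross (l i) (l j))) = 0.
Proof. by move=> ij; rewrite /config; have [->|->] := enum_set2 ij; vring. Qed.

End Parametrization.

Lemma config_map (R S : comNzRingType) (h : {rmorphism R -> S}) p l s t I :
  map_mx h (config p l s t I)
  = config (map_mx h p) (map_mx h \o l) (h \o s) (h \o t) I.
Proof.
rewrite /config; case: (enum I) => [|i [|j _]] //=.
by rewrite map_mxD !map_mxZ cross_map.
Qed.

Lemma config_exists (K : fieldType) (C : {set 'I_4} -> 'rV[K]_3) :
  admissible C -> exists p l s t, forall I : {set 'I_4},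
    (#|I| <= 2)%N -> C I = config p l s t I.
Proof.
move=> vC; pose l i := C [set i].
suff /fin_all_exists[st stP] : forall I : {set 'I_4}, exists st : K * K,
    (#|I| <= 2)%N -> C I = config (C set0) l (fun=> st.1) (fun=> st.2) I.
  exists (C set0), l, (fun I => (st I).1), (fun I => (st I).2) => I I2.
  by rewrite (stP I I2).
move=> I; have [I2|I2] := leqP #|I| 2; last by exists (0, 0).
case/cards_le2P: {+}I2 => [->|[i ->]|].
- by exists (0, 0); rewrite config0.
- by exists (0, 0); rewrite config1.
case=> i' [j' [ij' eI]].
have /card2_enum[i [j [ij -> e]]] : #|I| = 2%N by rewrite eI cards2 ij'.
have [qX _ /eqP] := vC _ _ ij; rewrite -mem_kerl -vline_addv //.
case/memv_addP=> _ /vlineP[s ->] [_ /vlineP[t ->] eC].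
by exists (s, t); rewrite /config e.
Qed.

(** * Density: two nonempty open sets meet *)

Section Density.
Variable K : fieldType.
Implicit Types (f : labelling K) (Q : K -> Prop).

(** A property of the elements of a field that can fail only at the roots of
    a nonzero polynomial. *)
Definition cofinitely Q :=
  exists2 r : {poly K}, r != 0 & forall t, r.[t] != 0 -> Q t.

Lemma cofinitely_and Q1 Q2 :
  cofinitely Q1 -> cofinitely Q2 -> cofinitely (fun t => Q1 t /\ Q2 t).
Proof.
case=> [r1 r1_neq0 h1] [r2 r2_neq0 h2].
exists (r1 * r2); first by rewrite mulf_neq0.
by move=> t; rewrite hornerM mulf_eq0 negb_or => /andP[/h1 ? /h2].
Qed.

Lemma cofinitely_all (T : finType) (Q : T -> K -> Prop) :
  (forall x, cofinitely (Q x)) -> cofinitely (fun t => forall x, Q x t).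
Proof.
move=> /fin_all_exists2[r r0 h]; exists (\prod_x r x); first exact/prodf_neq0.
by move=> t; rewrite horner_prod => /prodf_neq0 rt x; apply/h/rt.
Qed.

Lemma cofinitely_neq0 (r : {poly K}) t0 :
  r.[t0] != 0 -> cofinitely (fun t => r.[t] != 0).
Proof.
by move=> r0; exists r => //; apply: contraNneq r0 => ->; rewrite horner0.
Qed.

Lemma cofinitely_vec (v : 'rV[{poly K}]_3) t0 :
  map_mx (horner_eval t0) v != 0 ->
  cofinitely (fun t => map_mx (horner_eval t) v != 0).
Proof.
case/rV0Pn=> j; rewrite mxE => /cofinitely_neq0[r r0 h]; exists r => // t /h vt.
by apply/rV0Pn; exists j; rewrite mxE.
Qed.

(** A polynomial restricted to a polynomial curve. *)
Lemma mpoly_along n (p : {mpoly K[n]}) (v : 'I_n -> {poly K}) :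
  exists r : {poly K}, forall t, r.[t] = p.@[fun a => (v a).[t]].
Proof.
exists (mmap polyC v p) => t; rewrite mevalE /mmap horner_sum.
apply: eq_bigr => m _; rewrite hornerM hornerC /mmap1 horner_prod.
by under eq_bigr do rewrite horner_exp.
Qed.

Definition seg (a b : K) : {poly K} := a%:P + (b - a)%:P * 'X.

Lemma horner_seg a b t : (seg a b).[t] = a + (b - a) * t.
Proof. by rewrite /seg !hornerE. Qed.

Definition segv (u v : 'rV[K]_3) : 'rV[{poly K}]_3 :=
  \row_j seg (u 0 j) (v 0 j).

Lemma horner_segv u v t :
  map_mx (horner_eval t) (segv u v) = u + t *: (v - u).
Proof.
by apply/rowP=> j; rewrite !mxE /horner_eval horner_seg [_ * t]mulrC.
Qed.

Section SegmentConfig.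
Variables (p0 p1 : 'rV[K]_3) (l0 l1 : 'I_4 -> 'rV[K]_3).
Variables (s0 s1 t0 t1 : {set 'I_4} -> K).

Definition segment_config : {set 'I_4} -> 'rV[{poly K}]_3 :=
  config (segv p0 p1) (fun i => segv (l0 i) (l1 i))
    (fun I => seg (s0 I) (s1 I)) (fun I => seg (t0 I) (t1 I)).

Lemma segment_config0 I :
  map_mx (horner_eval 0) (segment_config I) = config p0 l0 s0 t0 I.
Proof.
rewrite config_map horner_segv scale0r addr0.
rewrite /config; case: (enum I) => [//|i [|j _]] /=; rewrite !horner_segv.
  by rewrite scale0r addr0.
by rewrite /horner_eval !horner_seg !mulr0 !scale0r !addr0.
Qed.

Lemma segment_config1 I :
  map_mx (horner_eval 1) (segment_config I) = config p1 l1 s1 t1 I.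
Proof.
have end1 (V : zmodType) (x y : V) : x + (y - x) = y by rewrite addrC subrK.
rewrite config_map horner_segv scale1r end1.
rewrite /config; case: (enum I) => [//|i [|j _]] /=; rewrite !horner_segv.
  by rewrite scale1r end1.
by rewrite /horner_eval !horner_seg !mulr1 !scale1r !end1.
Qed.

End SegmentConfig.

Hypothesis infK : forall r : {poly K}, r != 0 -> exists t, r.[t] != 0.

(** Irreducibility of the input space. Along the segment joining the data of
    a point of U to those of a point of V, each of the conditions of being in
    U, in V and in the input space is the nonvanishing of a polynomial in one
    variable, and each of these polynomials is nonzero at one of the two
    ends; so some value of the variable satisfies all of them. *)
Lemma zariski_open_meet (U V : labelling K -> Prop) :
  zariski_open U -> zariski_open V -> (exists f, U f) -> (exists f, V f) ->
  exists2 f, U f & V f.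
Proof.
move=> [inU [SU openU]] [inV [SV openV]] [f Uf] [g Vg].
have [cf fcf] := input_coord_exists (inU _ Uf).
have [cg gcg] := input_coord_exists (inV _ Vg).
have [p Sp pf] := (openU f cf (inU _ Uf) fcf).1 Uf.
have [q Sq qg] := (openV g cg (inV _ Vg) gcg).1 Vg.
have vf := coordinates_admissible (inU _ Uf) (input_coord_coordinates fcf).
have vg := coordinates_admissible (inV _ Vg) (input_coord_coordinates gcg).
have [p0 [l0 [s0 [t0 C0]]]] := config_exists vf.
have [p1 [l1 [s1 [t1 C1]]]] := config_exists vg.
pose CX := segment_config p0 p1 l0 l1 s0 s1 t0 t1.
pose c t (J : input) := map_mx (horner_eval t) (CX (val J)).
have c0E : c 0 = cf.
  apply: functional_extensionality => J.
  by rewrite /c segment_config0 -C0 ?(valP J) //= to_input_val.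
have c1E : c 1 = cg.
  apply: functional_extensionality => J.
  by rewrite /c segment_config1 -C1 ?(valP J) //= to_input_val.
pose v (a : 'I_nvars) := CX (val (enum_val a).1) 0 (enum_val a).2.
have flatE t : flatten_coord (c t) = fun a => (v a).[t].
  by apply: functional_extensionality => a; rewrite /flatten_coord mxE.
have [rp rpE] := mpoly_along p v; have [rq rqE] := mpoly_along q v.
(* The conditions of U hold at the value 0 and those of V at the value 1. *)
have cof_p : cofinitely (fun t => p.@[flatten_coord (c t)] != 0).
  have [|r r0 h] := @cofinitely_neq0 rp 0; first by rewrite rpE -flatE c0E.
  by exists r => // t /h; rewrite rpE flatE.
have cof_q : cofinitely (fun t => q.@[flatten_coord (c t)] != 0).
  have [|r r0 h] := @cofinitely_neq0 rq 1; first by rewrite rqE -flatE c1E.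
  by exists r => // t /h; rewrite rqE flatE.
pose C t (I : {set 'I_4}) := map_mx (horner_eval t) (CX I).
pose X (e : 'I_4 * 'I_4) :=
  cross (CX set0) (cross (CX [set e.1]) (CX [set e.2])).
have C0f (I : {set 'I_4}) : (#|I| <= 2)%N -> C 0 I = (cf \o to_input) I.
  by move=> I2; rewrite -c0E /= /c val_to_input.
have cof_X : cofinitely (fun t => forall e : 'I_4 * 'I_4, e.1 != e.2 ->
    map_mx (horner_eval t) (X e) != 0).
  apply: cofinitely_all => -[i j] /=; have [->|ij] := eqVneq i j.
    by exists 1; rewrite ?oner_neq0.
  have [|r r0 h] := @cofinitely_vec (X (i, j)) 0.
    rewrite /X -!cross_map -!/(C 0 _) !C0f ?cards0 ?cards1 //.
    by have [] := vf _ _ ij.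
  by exists r => // t /h.
have cof_F : cofinitely (fun t => forall e : 'I_4 * 'I_4, e.1 != e.2 ->
    C t [set e.1; e.2] != 0).
  apply: cofinitely_all => -[i j] /=; have [->|ij] := eqVneq i j.
    by exists 1; rewrite ?oner_neq0.
  have [|r r0 h] := @cofinitely_vec (CX [set i; j]) 0.
    by rewrite -/(C 0 _) C0f ?cards2 ?ij //; have [] := vf _ _ ij.
  by exists r => // t /h.
have [r r0 h] := cofinitely_and (cofinitely_and cof_p cof_q)
                                (cofinitely_and cof_X cof_F).
have [t /h[[pt qt] [Xt Ft]]] := infK r0.
have vC : admissible (C t).
  move=> i j ij; have e : cross (C t set0) (cross (C t [set i]) (C t [set j]))
      = map_mx (horner_eval t) (X (i, j)) by rewrite /C !cross_map.
  split; first by rewrite e (Xt (i, j)).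
    exact: (Ft (i, j)).
  rewrite e /C dot_map /X /CX /segment_config config0 !config1.
  by rewrite config_incident //=; apply: rmorph0.
pose k (I : {set 'I_4}) := flat_of #|I| (C t I).
have kin : input_space k by apply: (admissible_input_space vC).
have kc : input_coord (c t) k.
  by apply: (@coordinates_input_coord _ (C t)) => I /(admissible_neq0 vC).
exists k; first by apply/(openU k _ kin kc); exists p.
by apply/(openV k _ kin kc); exists q.
Qed.

End Density.

(** * A configuration in the generic locus *)

Section Example.
Variable K : fieldType.
Hypothesis two_neq0 : 2%:R != 0 :> K.

(** In this configuration a point and a line that are adjacent in the cube
    pair to 1, so that the points are already scaled, and all the
    determinants in [nondegeneracy] are 1, -1, 2 or -2. *)
Definition ex_line (i : nat) : 'rV[K]_3 :=
  nth 0 [:: vec3 1 0 0; vec3 0 1 0; vec3 0 0 1; vec3 1 (- 1) 1] i.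

Definition ex_point (i j : nat) : 'rV[K]_3 :=
  match minn i j, maxn i j with
  | 0, 1 => vec3 1 1 (- 2%:R)
  | 0, 2 => vec3 1 2%:R 1
  | 0, 3 => vec3 1 2%:R 2%:R
  | 1, 2 => vec3 0 1 1
  | 1, 3 => vec3 0 1 2%:R
  | _, _ => vec3 2%:R 2%:R 1
  end.

Definition ex_config (I : {set 'I_4}) : 'rV[K]_3 :=
  match enum I with
  | [::] => vec3 1 1 1
  | [:: i] => ex_line i
  | i :: j :: _ => ex_point i j
  end.

Lemma ex_pointC i j : ex_point i j = ex_point j i.
Proof. by rewrite /ex_point minnC maxnC. Qed.

Lemma ex_config0 : ex_config set0 = vec3 1 1 1.
Proof. by rewrite /ex_config enum_set0. Qed.

Lemma ex_config1 (i : 'I_4) : ex_config [set i] = ex_line i.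
Proof. by rewrite /ex_config enum_set1. Qed.

Lemma ex_config2 (i j : 'I_4) : i != j -> ex_config [set i; j] = ex_point i j.
Proof.
move=> ij; rewrite /ex_config.
by have [->|->] := enum_set2 ij; last exact: ex_pointC.
Qed.

Lemma vec3B (a b c a' b' c' : K) :
  vec3 a b c - vec3 a' b' c' = vec3 (a - a') (b - b') (c - c').
Proof. vring. Qed.

Lemma cross_vec3 (a b c a' b' c' : K) : cross (vec3 a b c) (vec3 a' b' c') =
  vec3 (b * c' - c * b') (c * a' - a * c') (a * b' - b * a').
Proof. vring. Qed.

Lemma dot_vec3 (a b c a' b' c' : K) :
  dot (vec3 a b c) (vec3 a' b' c') = a * a' + b * b' + c * c'.
Proof. vring. Qed.

Ltac small_unit :=
  rewrite /det3 /normal ?vec3B ?cross_vec3 ?dot_vec3;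
  match goal with |- is_true (?x != 0) => first
  [ have -> : x = 1 by ring
  | have -> : x = - 1 by ring
  | have -> : x = 2%:R by ring
  | have -> : x = - 2%:R by ring ]; rewrite ?oppr_eq0 ?oner_neq0 //
  end.

Lemma ex_lines_free (i j l : nat) : (i < 4)%N -> (j < 4)%N -> (l < 4)%N ->
  uniq [:: i; j; l] -> det3 (ex_line i) (ex_line j) (ex_line l) != 0.
Proof.
case: i => [|[|[|[|//]]]] _; case: j => [|[|[|[|//]]]] _ //;
  case: l => [|[|[|[|//]]]] _ // _; rewrite /ex_line /=; small_unit.
Qed.

Lemma ex_points_free (i j l : nat) : (i < 4)%N -> (j < 4)%N -> (l < 4)%N ->
  uniq [:: i; j; l] -> det3 (ex_point i j) (ex_point i l) (ex_point j l) != 0.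
Proof.
case: i => [|[|[|[|//]]]] _; case: j => [|[|[|[|//]]]] _ //;
  case: l => [|[|[|[|//]]]] _ // _; rewrite /ex_point /=; small_unit.
Qed.

Lemma ex_slope (i j : nat) : (i < 4)%N -> (j < 4)%N -> i != j ->
  dot (ex_point i j) (ex_line i) = 1.
Proof.
by case: i => [|[|[|[|//]]]] _; case: j => [|[|[|[|//]]]] _ // _;
  rewrite /ex_line /ex_point /=; vring.
Qed.

Lemma ex_base (i : nat) : (i < 4)%N -> dot (vec3 1 1 1) (ex_line i) = 1.
Proof. by case: i => [|[|[|[|//]]]] _; rewrite /ex_line /=; vring. Qed.

Lemma ex_planes_free (i j l m : nat) :
  (i < 4)%N -> (j < 4)%N -> (l < 4)%N -> (m < 4)%N -> uniq [:: i; j; l; m] ->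
  let N a b c := normal (ex_point a b) (ex_point a c) (ex_point b c) in
  det3 (N i j l) (N i j m) (N i l m) != 0.
Proof.
case: i => [|[|[|[|//]]]] _; case: j => [|[|[|[|//]]]] _ //;
  case: l => [|[|[|[|//]]]] _ //; case: m => [|[|[|[|//]]]] _ // _;
  rewrite /ex_point /=; small_unit.
Qed.

Lemma ex_admissible : admissible ex_config.
Proof.
move=> i j ij; rewrite ex_config0 !ex_config1 ex_config2 //.
have e1 := ex_base (ltn_ord i); have e2 := ex_base (ltn_ord j).
have ji : j != i by rewrite eq_sym.
have e3 := ex_slope (ltn_ord i) (ltn_ord j) ij.
have := ex_slope (ltn_ord j) (ltn_ord i) ji; rewrite ex_pointC => e4.
split.
- have [l u] := uniq_extend ij; rewrite cross_cross e1 e2 !scale1r.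
  rewrite -[uniq _](map_inj_uniq val_inj) in u.
  have [c _ _] := det3_neq0
    (ex_lines_free (ltn_ord i) (ltn_ord j) (ltn_ord l) u).
  by apply: contraNneq c => /subr0_eq->; rewrite crossvv.
- by apply: contraTneq (oner_neq0 K) => e; rewrite -e3 e dot0v eqxx.
- by rewrite cross_cross e1 e2 !scale1r dotBr e3 e4 subrr.
Qed.

Lemma generic_locus_nonempty : exists f : labelling K, generic_locus f.
Proof.
pose f : labelling K := fun I => flat_of #|I| (ex_config I).
have fC : coordinates ex_config f by move=> I /(admissible_neq0 ex_admissible).
exists f; split; first by apply: (admissible_input_space ex_admissible).
exists (ex_config \o val); first exact: coordinates_input_coord.
set C := _ \o to_input.
have C0 : C set0 = vec3 1 1 1.
  by rewrite /C /= val_to_input ?cards0 // ex_config0.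
have C1 i : C [set i] = ex_line i.
  by rewrite /C /= val_to_input ?cards1 // ex_config1.
have C2 (i j : 'I_4) : i != j -> C [set i; j] = ex_point i j.
  by move=> ij; rewrite /C /= val_to_input ?cards2 ?ij // ex_config2.
have slopeE (i j : 'I_4) : i != j -> slope C (i, j) = 1.
  by move=> ij; rewrite /slope C1 C2 //; apply: ex_slope.
have scaledE (i j : 'I_4) : i != j -> scaled C i j = ex_point i j.
  move=> ij; rewrite /scaled C0 C1 C2 // ex_base // big1 ?mulr1 ?scale1r //.
  by move=> [a b] /andP[/slopeE].
rewrite /nondegeneracy !mulf_neq0 //; apply/prodf_neq0.
- by move=> i _; rewrite C0 C1 ex_base ?oner_neq0.
- by move=> [i j] /slopeE->; rewrite oner_neq0.
- move=> [[i j] l] /= u; rewrite /line_condition !C1.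
  by apply: ex_lines_free => //; rewrite -[uniq _](map_inj_uniq val_inj) in u.
- move=> [[i j] l] /= u; have [ij il jl] := uniq3E u.
  rewrite /point_condition /= !scaledE //.
  by apply: ex_points_free => //; rewrite -[uniq _](map_inj_uniq val_inj) in u.
- move=> [[[i j] l] m] /= u; have [u1 u2 u3 u4] := uniq4E u.
  have [ij il jl] := uniq3E u1; have [_ im jm] := uniq3E u2.
  have [_ _ lm] := uniq3E u3.
  rewrite /plane_condition /face_normal /= !scaledE //.
  by apply: ex_planes_free => //; rewrite -[uniq _](map_inj_uniq val_inj) in u.
Qed.

End Example.

(** * The theorem *)

Section Infinite.
Variable K : fieldType.
Hypothesis char0 : forall n, n.+1%:R != 0 :> K.

Lemma natr_inj m n : m%:R = n%:R :> K -> m = n.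
Proof.
wlog le_mn : m n / (m <= n)%N.
  by move=> wl; case: (leqP m n) => [/wl//|/ltnW/wl h /esym/h].
move=> /esym/eqP; rewrite -subr_eq0 -natrB //.
case e : (n - m)%N => [|k]; last by rewrite (negPf (char0 k)).
by move=> _; apply/eqP; rewrite eqn_leq le_mn -subn_eq0 e.
Qed.

Lemma poly_nonroot (r : {poly K}) : r != 0 -> exists t, r.[t] != 0.
Proof.
move=> r0; pose s := [seq n%:R : K | n <- iota 0 (size r)].
have us : uniq s by rewrite map_inj_uniq ?iota_uniq // => m n; apply: natr_inj.
have [/(max_poly_roots r0)/(_ us)|] := boolP (all (root r) s).
  by rewrite size_map size_iota ltnn.
by move=> /allPn[t _ rt]; exists t.
Qed.

End Infinite.

Theorem theorem9p7 (R : realType) (K : fieldType)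
    (hK : K = R :> fieldType \/ K = R[i] :> fieldType) :
  (forall f : labelling K,
     (forall i j : 'I_4, (i < j)%N -> f [set i] != f [set j]) ->
     (forall i j : 'I_4, (i < j)%N -> coherent_face f set0 i j) ->
     input_space f) /\
  generically (fun f : labelling K =>
    [/\ forall i j : 'I_4, (i < j)%N -> coherent_face f set0 i j,
        forall i j k : 'I_4, (i < j < k)%N ->
          [/\ perspective_at f i j k,
              exists! D : flat K, desargues_at f i j k D
            & forall D : flat K, desargues_at f i j k D <-> coherent_at f i j k D]
      & (forall i j k : 'I_4, (i < j < k)%N ->
           desargues_at f i j k (f [set i; j; k])) ->
        exists P : flat K,
          unique (concurrent_at f) P /\
          unique (fun Q => coherent_cube (set_top f Q)) P]).
Proof.
have char0 n : n.+1%:R != 0 :> K.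
  by case: hK => ->; rewrite Num.Theory.pnatr_eq0.
split; first exact: coherent_input_space.
exists (@generic_locus K); split.
- exact: generic_locus_open.
- exact: (generic_locus_nonempty (char0 1%N)).
- move=> V openV exV; apply: (zariski_open_meet (poly_nonroot char0)) => //.
  + exact: generic_locus_open.
  + exact: (generic_locus_nonempty (char0 1%N)).
- exact: generic_locus_cube_property.
Qed.
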